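(* For all $m\ge r\ge 3$ and $\boldsymbol\mu=(\mu_1,\dots,\mu_r)\in\mathcal B_r(m)$, the assignments $$s'_i\mapsto w_\circ^{J_i(\boldsymbol\mu')},\quad i\in[1,r-1],\qquad s'_r\mapsto w_\circ^{[m-\mu_1+1,m]},$$ where $\boldsymbol\mu'=(\mu_2,\mu_2,\mu_3,\dots,\mu_r)\in\mathcal A_r(m-\mu_1+\mu_2)$, define a locally injective connected homomorphism of Hecke monoids $\theta_{\boldsymbol\mu}:(W(B_r),\star)\to(W(B_m),\star)$. Conversely, if $\phi:(W(B_r),\star)\to(W(B_m),\star)$ is a locally injective and connected homomorphism of Hecke monoids then $\phi=\theta_{\boldsymbol\mu}$ for some $\boldsymbol\mu\in\mathcal B_r(m)$.
   Context: For integers $a,b$ write $[a,b]=\{i\in\mathbb Z: a\le i\le b\}$. $B_n$ ($n\ge2$) denotes the Coxeter matrix over $[1,n]$ with $m_{i,i+1}=3$ for $i\le n-2$, $m_{n-1,n}=4$ and $m_{ij}=2$ for $|i-j|>1$. For a Coxeter matrix $M=(m_{ij})$ over a finite set $I$, the Hecke monoid $(W(M),\star)$ is generated by $s_i$, $i\in I$, subject to $s_i\star s_i=s_i$ and $s_i\star s_j\star\cdots=s_j\star s_i\star\cdots$ ($m_{ij}$ factors on each side) for $i\neq j$ with $m_{ij}<\infty$; its underlying set is identified with the Coxeter group $W(M)$ (a reduced word being sent to the $\star$-product of its letters). For $J\subset I$, $W_J(M)$ is the subgroup generated by $s_j$, $j\in J$; if it is finite, $w_\circ^J$ is its longest element.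 Generators of the domain are denoted $s'_i$. Homomorphisms of monoids preserve identity elements. For a homomorphism of Hecke monoids $\phi:(W(M'),\star)\to(W(M),\star)$, with $M'$ over $I'$ and $M$ over $I$, let $[\phi](i)$ be the support of $\phi(s'_i)$ (the set of indices occurring in a reduced expression) and $[\phi](J)=\bigcup_{j\in J}[\phi](j)$. $\phi$ is: locally injective if its restriction to $W_{\{i,j\}}(M')$ is injective for all $i\ne j\in I'$; connected if $[\phi](J)$ is a connected subset of $I$ for every connected $J\subset I'$, where a subset is connected if it induces a connected subgraph of the Coxeter graph (vertices $i,j$ joined iff $m_{ij}>2$). For $m,r\in\mathbb Z_{>0}$ put $$\mathcal A_r(m)=\{(\lambda_1,\dots,\lambda_r)\in\mathbb Z_{>0}^r: \lambda_1=\dots=\lambda_{r-2}\ge\lambda_{r-1}\ge\lambda_r,\ \textstyle\sum_{j}\lambda_j=m\},$$ $$\mathcal B_r(m)=\{(\lambda_1,\dots,\lambda_r)\in\mathbb Z_{>0}^r: \lambda_1\ge\lambda_2=\dots=\lambda_{r-1}\ge\lambda_r,\ \textstyle\sum_{j}\lambda_j=m\}.$$ For $\boldsymbol\lambda=(\lambda_1,\dots,\lambda_r)\in\mathbb Z_{>0}^r$ put $a_0(\boldsymbol\lambda)=0$, $a_i(\boldsymbol\lambda)=\lambda_r+\sum_{1\le j\le i-1}\lambda_j$ for $i\in[1,r]$, and $J_i(\boldsymbol\lambda)=[a_{i-1}(\boldsymbol\lambda)+1,a_{i+1}(\boldsymbol\lambda)-1]$ for $i\in[1,r-1]$.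
   Formalization: The converse additionally assumes that the supports of φ(s'_1),…,φ(s'_r) together cover [1,m]; without this it is false, e.g. s'_i ↦ s_{i+1} from B_3 to B_4. Every θ_μ satisfies this condition. *)

(* Defs.v *)
From HB Require Import structures.
From mathcomp Require Import all_boot.
From mathcomp Require Import boolp classical_sets.

Set Implicit Arguments.
Unset Strict Implicit.
Unset Printing Implicit Defensive.

Local Open Scope group_scope.
Local Open Scope quotient_scope.

(* Monoids given by generators and relations: words modulo the congruence
   generated by R. *)

Inductive pres_cong (T : Type) (R : seq T -> seq T -> Prop) :
    seq T -> seq T -> Prop :=
| pres_refl u : pres_cong R u u
| pres_sym u v : pres_cong R u v -> pres_cong R v u
| pres_trans u v w : pres_cong R u v -> pres_cong R v w -> pres_cong R u w
| pres_step u a b v : R a b -> pres_cong R (u ++ a ++ v) (u ++ b ++ v).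

Section Presentation.
Variables (T : choiceType) (R : seq T -> seq T -> Prop).

Definition pres_congb : rel (seq T) := fun u v => `[< pres_cong R u v >].

Lemma pres_congb_equiv : equiv_class_of pres_congb.
Proof.
split=> [u|u v|v u w].
- by apply/asboolP; exact: pres_refl.
- by apply/asboolP/asboolP; exact: pres_sym.
- by move=> /asboolP uv /asboolP vw; apply/asboolP; exact: pres_trans uv vw.
Qed.

Canonical pres_equiv := EquivRelPack pres_congb_equiv.

Definition presented := {eq_quot pres_equiv}.
HB.instance Definition _ := Choice.on presented.

Definition pres_word (u : seq T) : presented := \pi_{eq_quot pres_equiv} u.

Lemma pres_wordP u v : (pres_word u = pres_word v) <-> pres_cong R u v.
Proof. by split=> [/eqmodP/asboolP //|uv]; apply/eqmodP/asboolP. Qed.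

Lemma pres_reprK (x : presented) : pres_word (repr x) = x.
Proof. exact: reprK. Qed.

Lemma pres_cong_catl w u v :
  pres_cong R u v -> pres_cong R (w ++ u) (w ++ v).
Proof.
elim=> {u v} [u|u v _|u v t _ + _|u a b v ab]; first exact: pres_refl.
- exact: pres_sym.
- exact: pres_trans.
- by rewrite !(catA w); exact: pres_step.
Qed.

Lemma pres_cong_catr w u v :
  pres_cong R u v -> pres_cong R (u ++ w) (v ++ w).
Proof.
elim=> {u v} [u|u v _|u v t _ + _|u a b v ab]; first exact: pres_refl.
- exact: pres_sym.
- exact: pres_trans.
- by rewrite -!catA; exact: pres_step.
Qed.

Definition pres_mul (x y : presented) : presented :=
  pres_word (repr x ++ repr y).

Definition pres_one : presented := pres_word [::].

Lemma pres_word_mul u v : pres_mul (pres_word u) (pres_word v) =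
  pres_word (u ++ v).
Proof.
apply/pres_wordP.
apply: (pres_trans (v := repr (pres_word u) ++ v)).
  by apply/pres_cong_catl/pres_wordP; rewrite pres_reprK.
by apply/pres_cong_catr/pres_wordP; rewrite pres_reprK.
Qed.

Lemma pres_mulA : associative pres_mul.
Proof.
move=> x y z; rewrite -(pres_reprK x) -(pres_reprK y) -(pres_reprK z).
by rewrite !pres_word_mul catA.
Qed.

Lemma pres_mul1 : left_id pres_one pres_mul.
Proof. by move=> x; rewrite -(pres_reprK x) pres_word_mul. Qed.

Lemma pres_mul1r : right_id pres_one pres_mul.
Proof. by move=> x; rewrite -(pres_reprK x) pres_word_mul cats0. Qed.

HB.instance Definition _ :=
  isMonoid.Build presented pres_mulA pres_mul1 pres_mul1r.

Lemma pres_word_cat u v : pres_word (u ++ v) = pres_word u * pres_word v.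
Proof. by rewrite [RHS]pres_word_mul. Qed.

Lemma pres_word_prod u : pres_word u = \prod_(i <- u) pres_word [:: i].
Proof.
by elim: u => [|i u IH]; rewrite ?big_nil // big_cons -IH -pres_word_cat.
Qed.

End Presentation.

(* The entry 0 encodes m_ij = oo. *)
Record coxeterMatrix (I : finType) := CoxeterMatrix {
  cox_m :> I -> I -> nat;
  cox_mC : forall i j, cox_m i j = cox_m j i;
  cox_m1 : forall i j, (cox_m i j == 1%N) = (i == j) }.

(* i j i ... (n letters) *)
Definition alternating (I : Type) (i j : I) (n : nat) : seq I :=
  mkseq (fun k => if odd k then j else i) n.

Section Coxeter.
Variables (I : finType) (M : coxeterMatrix I).

(* (s_i s_j)^(m_ij) = 1; for i = j this is s_i^2 = 1, so the monoid with these
   relations is the Coxeter group. For m_ij = oo the relation is [::] = [::]. *)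
Inductive cox_rel : seq I -> seq I -> Prop :=
| CoxRel i j : cox_rel (flatten (nseq (M i j) [:: i; j])) [::].

(* For m_ij = oo the braid relation is [::] = [::]. *)
Inductive hecke_rel : seq I -> seq I -> Prop :=
| HeckeIdem i : hecke_rel [:: i; i] [:: i]
| HeckeBraid i j : i != j ->
    hecke_rel (alternating i j (M i j)) (alternating j i (M i j)).

Definition coxeter := presented cox_rel.
HB.instance Definition _ := Monoid.on coxeter.

Definition hecke := presented hecke_rel.
HB.instance Definition _ := Monoid.on hecke.

Definition cox_word (u : seq I) : coxeter := pres_word cox_rel u.
Definition cox_gen (i : I) : coxeter := cox_word [:: i].
Definition hecke_word (u : seq I) : hecke := pres_word hecke_rel u.
Definition hecke_gen (i : I) : hecke := hecke_word [:: i].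

Definition cox_inv (x : coxeter) : coxeter := cox_word (rev (repr x)).

Lemma cox_gen2 i : cox_word [:: i; i] = 1.
Proof.
apply/pres_wordP; have := CoxRel i i.
have /eqP -> : M i i == 1%N by rewrite cox_m1.
by move=> /(pres_step [::] [::]).
Qed.

Lemma cox_word_cat u v : cox_word (u ++ v) = cox_word u * cox_word v.
Proof. exact: pres_word_cat. Qed.

Lemma cox_word_rev u : cox_word (rev u) * cox_word u = 1.
Proof.
elim: u => [|i u IH]; first by rewrite -cox_word_cat.
rewrite rev_cons -cats1 -(cat1s i u) !cox_word_cat -mulgA.
rewrite (mulgA (cox_word [:: i])) -(cox_word_cat [:: i] [:: i]).
by rewrite [cox_word ([:: i] ++ _)](cox_gen2 i) mul1g.
Qed.

Lemma cox_mulV : left_inverse 1 cox_inv *%g.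
Proof. by move=> x; rewrite -[x in _ * x](pres_reprK x); exact: cox_word_rev. Qed.

Lemma cox_mulrV : right_inverse 1 cox_inv *%g.
Proof.
move=> x; rewrite -[x in x * _](pres_reprK x) /cox_inv.
by have := cox_word_rev (rev (repr x)); rewrite revK.
Qed.

HB.instance Definition _ := hasInv.Build coxeter cox_inv.
HB.instance Definition _ := Monoid_isGroup.Build coxeter cox_mulV cox_mulrV.

Lemma cox_exprP (w : coxeter) :
  exists n, `[< exists2 u, size u = n & cox_word u = w >].
Proof.
exists (size (repr w)); apply/asboolP; exists (repr w) => //.
exact: pres_reprK.
Qed.

Definition cox_length (w : coxeter) : nat := ex_minn (cox_exprP w).

Definition reduced (u : seq I) : bool := size u == cox_length (cox_word u).

(* The identification of the Coxeter group with the Hecke monoid (independent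
   of the choice of the reduced word, by Matsumoto's theorem). *)
Definition hecke_of_cox (w : coxeter) : hecke :=
  hecke_word (xget [::] [set u | reduced u /\ cox_word u = w]%classic).

Definition is_subgroup (S : set coxeter) : Prop :=
  [/\ S 1, (forall x y, S x -> S y -> S (x * y)) & forall x, S x -> S x^-1].

Definition parabolic (J : {set I}) : set coxeter :=
  smallest is_subgroup [set cox_gen j | j in [set` J]]%classic.

Definition is_longest (J : {set I}) (w : coxeter) : Prop :=
  parabolic J w /\ forall v, parabolic J v -> (cox_length v <= cox_length w)%N.

(* Meaningful when the subgroup is finite; 1 if there is no longest element. *)
Definition cox_longest (J : {set I}) : coxeter :=
  xget 1 [set w | is_longest J w]%classic.

Definition hecke_parabolic (J : {set I}) : set hecke :=
  [set hecke_of_cox w | w in parabolic J]%classic.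

Definition hecke_longest (J : {set I}) : hecke :=
  hecke_of_cox (cox_longest J).

Definition hecke_supp (x : hecke) : {set I} :=
  [set i | `[< exists u, [/\ reduced u, hecke_word u = x & i \in u] >]]%SET.

(* i and j are joined iff m_ij > 2, including m_ij = oo. *)
Definition cox_adj : rel I := fun i j => (M i j == 0%N) || (2 < M i j)%N.

Definition connected_subset (J : {set I}) : bool :=
  [forall i in J, forall j in J,
     connect (fun x y => [&& x \in J, y \in J & cox_adj x y]) i j].

End Coxeter.

Arguments hecke_parabolic {I} M J _.

Section HeckeHom.
Variables (I' I : finType) (M' : coxeterMatrix I') (M : coxeterMatrix I).

Definition heckeHom := UMagmaMorphism.type (hecke M') (hecke M).

Implicit Type phi : hecke M' -> hecke M.

Definition locally_injective phi : Prop :=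
  forall i j : I', i != j ->
    {in hecke_parabolic M' [set i; j]%SET &, injective phi}.

Definition hom_supp phi (J : {set I'}) : {set I} :=
  (\bigcup_(j in J) hecke_supp (phi (hecke_gen M' j)))%SET.

Definition connected_hom phi : Prop :=
  forall J : {set I'}, connected_subset M' J ->
    connected_subset M (hom_supp phi J).

(* Every theta_mu below has this property. It is not automatic: for r < m the
   embedding s'_i |-> s_(i + m - r) of B_r as a parabolic submonoid of B_m is
   locally injective and connected. *)
Definition fully_supported phi : Prop :=
  hom_supp phi [set: I']%SET = [set: I]%SET.

Lemma heckeHom_ext (phi psi : heckeHom) :
  (forall i, phi (hecke_gen M' i) = psi (hecke_gen M' i)) -> phi =1 psi.
Proof.
move=> eq_gen x; rewrite -(pres_reprK x); elim: (repr x) => [|i u IH].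
  by rewrite -[pres_word _ _]/(1 : hecke M') !gmulf1.
by rewrite -cat1s pres_word_cat !gmulfM IH; congr (_ * _); exact: eq_gen.
Qed.

End HeckeHom.

(* Type B_n. The ordinal i stands for the vertex i + 1 of [1, n]. *)
Definition coxB_m (n : nat) (i j : 'I_n) : nat :=
  if i == j then 1%N
  else if (i.+1 == j) || (j.+1 == i) then
    if (maxn i j).+1 == n then 4%N else 3%N
  else 2%N.

Lemma coxB_mC n (i j : 'I_n) : coxB_m i j = coxB_m j i.
Proof. by rewrite /coxB_m eq_sym orbC maxnC. Qed.

Lemma coxB_m1 n (i j : 'I_n) : (coxB_m i j == 1%N) = (i == j).
Proof. by rewrite /coxB_m; case: eqP => //; do ?case: ifP. Qed.

Definition coxB (n : nat) : coxeterMatrix 'I_n :=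
  CoxeterMatrix (@coxB_mC n) (@coxB_m1 n).

(* [a, b] as a set of vertices of B_n. *)
Definition interval (n a b : nat) : {set 'I_n} :=
  [set k : 'I_n | (a <= k.+1 <= b)%N]%SET.

(* lambda_j, with j counted from 1 *)
Definition part (l : seq nat) (j : nat) : nat := nth 0%N l j.-1.

Definition posA (r m : nat) (l : seq nat) : Prop :=
  [/\ size l = r,
      forall j, (1 <= j <= r)%N -> (0 < part l j)%N,
      forall j, (1 <= j <= r - 2)%N -> part l j = part l 1,
      (part l r <= part l (r - 1) <= part l (r - 2))%N
    & (\sum_(1 <= j < r.+1) part l j)%N = m].

Definition posB (r m : nat) (l : seq nat) : Prop :=
  [/\ size l = r,
      forall j, (1 <= j <= r)%N -> (0 < part l j)%N,
      forall j, (2 <= j <= r - 1)%N -> part l j = part l 2,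
      (part l r <= part l (r - 1))%N && (part l 2 <= part l 1)%N
    & (\sum_(1 <= j < r.+1) part l j)%N = m].

Definition endpoint (l : seq nat) (i : nat) : nat :=
  if i == 0%N then 0%N
  else (part l (size l) + \sum_(1 <= j < i) part l j)%N.

Definition blockJ (m : nat) (l : seq nat) (i : nat) : {set 'I_m} :=
  interval m ((endpoint l i.-1).+1) ((endpoint l i.+1).-1).

(* (mu_2, mu_2, mu_3, ..., mu_r) *)
Definition mu_prime (mu : seq nat) : seq nat := part mu 2 :: behead mu.

Definition theta_gen (r m : nat) (mu : seq nat) (i : 'I_r) : hecke (coxB m) :=
  if (i.+1 < r)%N then hecke_longest (coxB m) (blockJ m (mu_prime mu) i.+1)
  else hecke_longest (coxB m) (interval m (m - part mu 1).+1 m).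

(* Main.v *)
(** The Hecke monoid of B_n acts faithfully on integer words of length n: s_i with
    i < n sorts positions i and i + 1 in decreasing order, and s_n replaces the last
    letter by its absolute value. Faithfulness is Matsumoto's theorem for the signed
    permutations reached from (-n, ..., -1). A potential that strictly increases at
    every effective sorting step shows that each idempotent is the longest element of
    the parabolic submonoid on its support; hence the images of the generators are
    longest elements of intervals, which sort whole blocks of letters.

    Replacing a word by the counting functions k |-> #{j < k | x_j >= t} of its
    antisymmetric double turns a block sort of [lo, hi] into
    C k := min (C lo + k - lo) (C hi). Let J and K be two non-nested intervals whose
    blocks overlap in o positions, with u and v positions left over on the left and
    on the right. They never commute; w_J w_K w_J = w_K w_J w_K holds iff neither
    contains n and u, v <= o; and if K contains n, w_J w_K w_J w_K =
    w_K w_J w_K w_J holds iff u <= o. Along the chain of intervals [phi](1), ...,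
    [phi](r) these inequalities run in a circle, so all the overlaps are equal,
    which is the shape of theta_mu. *)

From HB Require Import structures.
From Stdlib Require Import ZArith Lia.
Require Import Defs.
From mathcomp Require Import all_boot zify.
From mathcomp Require Import boolp classical_sets.

Set Implicit Arguments.
Unset Strict Implicit.
Unset Printing Implicit Defensive.

Local Open Scope group_scope.

Implicit Types (x y : nat -> Z).

(** The definitions speak of lengths and reduced words in a presented group, the theorem of products
    in the Hecke monoid. The bridge is [absorbs]: a longest element is a product of letters of J
    fixed by left multiplication by each of them. Reversal of words shows that there is only one
    such element, and later identities become statements about which generators fix an image.
    Faithfulness needs only the orbit of (-n, ..., -1), but the relations hold on all integer words;
    words with many equal letters can therefore serve as tests, and a single one refutes an
    identity. Doubling turns the sign change into an exchange of neighbours, so that an interval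
    containing n becomes one symmetric block. Injectivity concerns rank two submonoids only, whose
    elements are alternating words; incomparable supports and the words one letter short of the full
    one decide it. The relation of length four bounds the left margin u but not v, which is why mu_1
    may exceed mu_2; the left margin of the first pair is bounded only from above, which is why mu_r
    may fall short of mu_2. *)

Ltac at_point := rewrite ?eqxx /=; repeat match goal with
  | |- context[?a == ?b] =>
    first [ have -> : (a == b) = true by lia | have -> : (a == b) = false by lia ]
  end; try done; try lia.

Ltac at_cases k l :=
  lazymatch l with
  | (?a, ?l') => have [?|?] := eqVneq k a; [subst k | at_cases k l']
  | _ => idtac
  end; at_point.

(** * Signed permutations and Matsumoto's theorem *)

Section Operators.
Variable n : nat.

(* Words are functions on nat of which only the first n values matter; positions
   are counted from 0, so i.+1 == n selects the last vertex of B_n. *)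
Definition refl (i : nat) x : nat -> Z := fun k =>
  if i.+1 == n then (if k == i then - x i else x k)%Z
  else if k == i then x i.+1 else if k == i.+1 then x i else x k.

Definition bsort (i : nat) x : nat -> Z := fun k =>
  if i.+1 == n then (if k == i then Z.abs (x i) else x k)
  else if k == i then Z.max (x i) (x i.+1)
  else if k == i.+1 then Z.min (x i) (x i.+1) else x k.

(** Strict, whereas [sorted_at] allows ties: with repeated letters the fixed points of [bsort] are
    the weakly sorted words. On signed permutations the two conditions agree. *)
Definition desc (i : nat) x : bool :=
  if i.+1 == n then (0 <? x i)%Z else (x i.+1 <? x i)%Z.

Definition sorted_at (i : nat) x : bool :=
  if i.+1 == n then (0 <=? x i)%Z else (x i.+1 <=? x i)%Z.

Lemma bsort_id i x : sorted_at i x -> bsort i x = x.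
Proof.
rewrite /sorted_at /bsort => h; apply/funext => k; move: h.
by case: eqP => e h; at_cases k (i, (i.+1, tt)).
Qed.

Lemma bsort_fix i x : bsort i x = x -> sorted_at i x.
Proof.
rewrite /sorted_at /bsort => /(congr1 (fun f => f i)); rewrite eqxx.
by case: eqP => _; lia.
Qed.

Lemma bsort_refl i x : ~~ desc i x -> bsort i x = refl i x.
Proof.
rewrite /desc /bsort /refl => h; apply/funext => k; move: h.
by case: eqP => e h; at_cases k (i, (i.+1, tt)).
Qed.

Lemma desc_sorted i x : desc i x -> sorted_at i x.
Proof. by rewrite /desc /sorted_at; case: eqP => _; lia. Qed.

Lemma reflK i : involutive (refl i).
Proof.
move=> x; apply/funext => k; rewrite /refl.
by case: eqP => e; at_cases k (i, (i.+1, tt)).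
Qed.

Lemma bsort_idem i x : bsort i (bsort i x) = bsort i x.
Proof.
apply: bsort_id; rewrite /sorted_at /bsort.
by case: eqP => ?; at_point.
Qed.

Lemma refl_far i j x : i.+1 < j < n -> refl i (refl j x) = refl j (refl i x).
Proof.
move=> h; apply/funext => k; rewrite /refl.
by have [e|ne] := eqVneq j.+1 n; at_cases k (i, (i.+1, (j, (j.+1, tt)))).
Qed.

Lemma bsort_far i j x : i.+1 < j < n ->
  bsort i (bsort j x) = bsort j (bsort i x).
Proof.
move=> h; apply/funext => k; rewrite /bsort.
by have [e|ne] := eqVneq j.+1 n; at_cases k (i, (i.+1, (j, (j.+1, tt)))).
Qed.

Lemma refl_braid3 i x : i.+2 < n ->
  refl i (refl i.+1 (refl i x)) = refl i.+1 (refl i (refl i.+1 x)).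
Proof.
by move=> h; apply/funext => k; rewrite /refl; at_cases k (i, (i.+1, (i.+2, tt))).
Qed.

Lemma bsort_braid3 i x : i.+2 < n ->
  bsort i (bsort i.+1 (bsort i x)) = bsort i.+1 (bsort i (bsort i.+1 x)).
Proof.
by move=> h; apply/funext => k; rewrite /bsort; at_cases k (i, (i.+1, (i.+2, tt))).
Qed.

Lemma refl_braid4 i x : i.+2 = n ->
  refl i (refl i.+1 (refl i (refl i.+1 x))) =
  refl i.+1 (refl i (refl i.+1 (refl i x))).
Proof.
by move=> h; apply/funext => k; rewrite /refl; at_cases k (i, (i.+1, tt)).
Qed.

Lemma bsort_braid4 i x : i.+2 = n ->
  bsort i (bsort i.+1 (bsort i (bsort i.+1 x))) =
  bsort i.+1 (bsort i (bsort i.+1 (bsort i x))).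
Proof.
by move=> h; apply/funext => k; rewrite /bsort; at_cases k (i, (i.+1, tt)).
Qed.

Lemma coxB_cases (i j : 'I_n) : i < j ->
  [\/ coxB n i j = 2 /\ i.+1 < j < n,
      coxB n i j = 3 /\ j = i.+1 :> nat /\ i.+2 < n
    | coxB n i j = 4 /\ j = i.+1 :> nat /\ i.+2 = n].
Proof.
move=> lij; rewrite /= /coxB_m; have := ltn_ord j.
have -> : (i == j) = false by apply/eqP => e; move: lij; rewrite e ltnn.
have -> : maxn i j = j by lia.
case: ifP => h1; last by constructor 1; lia.
by case: ifP => h2; [constructor 3|constructor 2]; lia.
Qed.

Definition wact (f : nat -> (nat -> Z) -> nat -> Z) (u : seq 'I_n) x :=
  foldr (fun i : 'I_n => f i) x u.

Lemma wact_cat f u v x : wact f (u ++ v) x = wact f u (wact f v x).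
Proof. by rewrite /wact foldr_cat. Qed.

Lemma wact_cong f R (u v : seq 'I_n) :
  (forall a b, R a b -> forall x, wact f a x = wact f b x) ->
  pres_cong R u v -> forall x, wact f u x = wact f v x.
Proof.
move=> hR; elim=> // {u v}.
- by move=> u v w _ h1 _ h2 x; rewrite h1.
- by move=> u a b v h x; rewrite !wact_cat (hR _ _ h).
Qed.

Lemma wact_braid f :
  (forall i j x, i.+1 < j < n -> f i (f j x) = f j (f i x)) ->
  (forall i x, i.+2 < n -> f i (f i.+1 (f i x)) = f i.+1 (f i (f i.+1 x))) ->
  (forall i x, i.+2 = n -> f i (f i.+1 (f i (f i.+1 x))) =
    f i.+1 (f i (f i.+1 (f i x)))) ->
  forall (i j : 'I_n) x, i != j ->
  wact f (alternating i j (coxB n i j)) x =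
  wact f (alternating j i (coxB n i j)) x.
Proof.
move=> f2 f3 f4 i j x.
wlog lij : i j / i < j => [W hij|_].
  have [lij|lji|e] := ltngtP i j; first exact: W.
    by have /= -> := coxB_mC i j; rewrite W // eq_sym.
  by move: hij; rewrite (val_inj e) eqxx.
have [[-> h]|[-> [h1 h2]]|[-> [h1 h2]]] := coxB_cases lij;
  rewrite /alternating /mkseq /= ?h1.
- exact: f2.
- exact: f3.
- exact: f4.
Qed.

Lemma refl_braid (i j : 'I_n) x : i != j ->
  wact refl (alternating i j (coxB n i j)) x =
  wact refl (alternating j i (coxB n i j)) x.
Proof. exact: (wact_braid refl_far refl_braid3 refl_braid4). Qed.

Lemma wact_hecke_cong u v : pres_cong (hecke_rel (coxB n)) u v ->
  forall x, wact bsort u x = wact bsort v x.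
Proof.
apply: wact_cong => a b; case=> [i|i j hij] x; first exact: bsort_idem.
exact: (wact_braid bsort_far bsort_braid3 bsort_braid4).
Qed.


(** The relation for (s_i s_j)^m follows from the braid relation by cancelling involutions one at a
    time; off the diagonal m is 2, 3 or 4. *)
Lemma refl_cox_cong u v : pres_cong (cox_rel (coxB n)) u v ->
  forall x, wact refl u x = wact refl v x.
Proof.
apply: wact_cong => a b; case=> i j x /=.
have [<-|hij] := eqVneq i j.
  by rewrite /coxB_m eqxx; exact: reflK.
have rK k z : refl k (refl k z) = z := reflK k z.
move: (refl_braid x hij).
rewrite /=; have : coxB_m i j \in [:: 2; 3; 4].
  by rewrite /coxB_m (negbTE hij); case: ifP => // _; case: ifP.
rewrite !inE => /or3P[] /eqP ->; rewrite /alternating /mkseq /=.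
- by move=> ->; rewrite !rK.
- by move=> <-; rewrite !rK.
- by move=> ->; rewrite !rK.
Qed.

End Operators.

(** * Integer partial sums under a change of one or two entries *)

Section PartialSums.

Fixpoint psum (f : nat -> Z) (j : nat) : Z :=
  if j is j'.+1 then (psum f j' + f j')%Z else 0%Z.

Lemma psum_le f g j : (forall k, k < j -> (f k <= g k)%Z) ->
  (psum f j <= psum g j)%Z.
Proof.
elim: j => [|j IH] h /=; first by lia.
by have := h j (ltnSn j); have := IH (fun k hk => h k (ltnW hk)); lia.
Qed.

Lemma psum_eq f g j : (forall k, k < j -> f k = g k) -> psum f j = psum g j.
Proof.
by move=> h; apply: Z.le_antisymm; apply: psum_le => k hk; rewrite h //; lia.
Qed.

Lemma psum_eq1 f g j i : i < j -> (forall k, k <> i -> f k = g k) ->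
  (psum g j - psum f j = g i - f i)%Z.
Proof.
move=> lij h; elim: j lij => //= j IH lij.
have [lt|ge] := ltnP i j; first by have := IH lt; rewrite (h j); lia.
have -> : j = i by lia.
have : psum f i = psum g i by apply: psum_eq => k hk; apply: h; lia.
by lia.
Qed.

Lemma psum_eq2 f g j i : i.+1 < j ->
  (forall k, k <> i -> k <> i.+1 -> f k = g k) ->
  (psum g j - psum f j = g i - f i + (g i.+1 - f i.+1))%Z.
Proof.
move=> lij h; elim: j lij => //= j IH lij.
have [lt|ge] := ltnP i.+1 j; first by have := IH lt; rewrite (h j); lia.
have -> : j = i.+1 by lia.
(* [g'] differs from [f] only at [i], which reduces the claim to [psum_eq1]. *)
pose g' k := if k == i.+1 then f k else g k.
have h' k : k <> i -> f k = g' k by rewrite /g'; case: eqP => // ? ?; exact: h.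
have := psum_eq1 (ltnSn i) h'.
have -> : psum g' i.+1 = psum g i.+1.
  by apply: psum_eq => k hk; rewrite /g'; have -> : (k == i.+1) = false by lia.
rewrite /g'; have -> : (i == i.+1) = false by lia.
by lia.
Qed.

End PartialSums.

(** * The potential and the fixed points of sorting words *)

Section Potential.
Variable n : nat.

(** The weights n, ..., 1 are positive and strictly decreasing, so moving a larger letter to the
    left and making the last letter positive both raise the sum. *)
Definition pot x : Z := psum (fun k => (Z.of_nat (n - k) * x k)%Z) n.

Lemma bsort_pot i x : i < n -> (pot x <= pot (bsort n i x))%Z /\
  (pot x = pot (bsort n i x) -> bsort n i x = x).
Proof.
move=> lin; have [s|ns] := boolP (sorted_at n i x); first by rewrite bsort_id //; split=> //; lia.
suff h : (pot x < pot (bsort n i x))%Z.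
  by split=> [|e]; [lia|exfalso; lia].
move: ns; rewrite /sorted_at /pot.
pose f k := (Z.of_nat (n - k) * x k)%Z; rewrite -/f.
pose g k := (Z.of_nat (n - k) * bsort n i x k)%Z; rewrite -/g.
case: eqP => [e|ne] ns.
  have h k : k <> i -> f k = g k.
    by move=> /eqP/negbTE; rewrite /f /g /bsort e eqxx => ->.
  have := psum_eq1 lin h; rewrite /f /g /bsort e !eqxx.
  have -> : n - i = 1%N by lia.
  by lia.
have en : (i.+1 == n) = false by lia.
have ei : (i.+1 == i) = false by lia.
have h k : k <> i -> k <> i.+1 -> f k = g k.
  by move=> /eqP/negbTE e1 /eqP/negbTE e2; rewrite /f /g /bsort en e1 e2.
have lin' : i.+1 < n by lia.
have := psum_eq2 lin' h; rewrite /f /g /bsort en ei !eqxx.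
have -> : (Z.of_nat (n - i) = Z.of_nat (n - i.+1) + 1)%Z by lia.
by nia.
Qed.

Lemma wact_bsort_pot (u : seq 'I_n) x : (pot x <= pot (wact (bsort n) u x))%Z.
Proof.
elim: u => [|i u IH] /=; first by lia.
by have [] := bsort_pot (wact (bsort n) u x) (ltn_ord i); lia.
Qed.

(** The potential never drops along the word and ends at its initial value, so no single step
    changes anything. *)
Lemma wact_bsort_fix (u : seq 'I_n) x : wact (bsort n) u x = x ->
  forall i, i \in u -> bsort n i x = x.
Proof.
elim: u => //= j u IH e i.
have [le1 eq1] := bsort_pot (wact (bsort n) u x) (ltn_ord j).
have le2 := @wact_bsort_pot u x.
rewrite e in le1 eq1.
have e2 : wact (bsort n) u x = x by apply/esym/eq1; lia.
rewrite inE => /orP[/eqP ->|]; first by rewrite -[in LHS]e2.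
exact: IH.
Qed.

End Potential.

(** * Signed permutations and words of ascents *)

Section Generic.
Variable n : nat.

(** The word (-n, ..., -1). Truncated subtraction makes it vanish from position n on, as
    [generic_out] demands, so that words can be compared as functions. *)
Definition base : nat -> Z := fun k => (- Z.of_nat (n - k))%Z.

Record generic x : Prop := Generic {
  generic_bound : forall k, k < n -> (1 <= Z.abs (x k) <= Z.of_nat n)%Z;
  generic_dist : forall k l, k < l < n -> Z.abs (x k) <> Z.abs (x l);
  generic_out : forall k, n <= k -> x k = 0%Z }.

Lemma generic_base : generic base.
Proof. by split=> [k|k l|k] h; rewrite /base; lia. Qed.

Lemma desc_base i : i < n -> ~~ desc n i base.
Proof. by move=> h; rewrite /desc /base; case: eqP => ?; lia. Qed.

Lemma desc_refl i x : desc n i x -> ~~ desc n i (refl n i x).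
Proof.
rewrite /desc /refl eqxx; case: eqP => [e|ne]; first by lia.
have -> : (i.+1 == i) = false by lia.
by rewrite eqxx; lia.
Qed.

Lemma generic_desc_refl i x : i < n -> generic x -> ~~ desc n i x ->
  desc n i (refl n i x).
Proof.
move=> lin [g1 g2 g3]; rewrite /desc /refl eqxx; case: eqP => [e|ne].
  by have := g1 i lin; lia.
have -> : (i.+1 == i) = false by lia.
by rewrite eqxx; have := @g2 i i.+1; lia.
Qed.

Lemma generic_refl i x : i < n -> generic x -> generic (refl n i x).
Proof.
move=> lin [g1 g2 g3].
have ei : (i.+1 == i) = false by lia.
rewrite /refl; case: eqP => [e|ne].
  split=> [k|k l|k] h.
  - by have := g1 i; have := g1 k; case: (eqVneq k i) => [_|_]; lia.
  - by have := g2 k l h; case: (eqVneq k i) => [ek|_];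
      case: (eqVneq l i) => [el|_]; try subst k; try subst l; lia.
  - by have := g3 k h; case: (eqVneq k i) => [ek|_]; try subst k; lia.
split=> [k|k l|k] h.
- by case: (eqVneq k i) => [e|_]; [apply: g1; lia|case: (eqVneq k i.+1) => _; apply: g1; lia].
- have E a b : a <> b -> a < n -> b < n -> Z.abs (x a) <> Z.abs (x b).
    move=> nab la lb; have [lt|gt|//] := ltngtP a b; first by apply: g2; lia.
    by have := g2 b a; lia.
  case: (eqVneq k i) => [ek|nk]; case: (eqVneq l i) => [el|nl];
  case: (eqVneq k i.+1) => [ek'|nk']; case: (eqVneq l i.+1) => [el'|nl'];
  apply: E; lia.
- by have := g3 k h; have := g3 i.+1; case: (eqVneq k i) => [ek|_];
    case: (eqVneq k i.+1) => [el|_]; try subst k; lia.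
Qed.

Lemma generic_min x : generic x -> (forall i, i < n -> ~~ desc n i x) -> x = base.
Proof.
move=> [g1 g2 g3] nd; apply/funext => k; rewrite /base.
have [lkn|] := ltnP k n; last by move=> h; rewrite g3 //; lia.
have inc i : i.+1 < n -> (x i < x i.+1)%Z.
  move=> h; have := nd i; rewrite /desc; have := g2 i i.+1.
  by case: eqP; lia.
have neg : (x n.-1 < 0)%Z.
  have := nd n.-1; rewrite /desc; have := g1 n.-1.
  by case: eqP; lia.
(* The letters increase strictly within [-n, -1]; counting from both ends leaves one possibility for
   each. *)
have lo i : i < n -> (- Z.of_nat n + Z.of_nat i <= x i)%Z.
  elim: i => [|i IH] h; first by have := g1 0%N; lia.
  by have := inc i h; have := IH (ltnW h); lia.
have hi i : i < n -> (x (n.-1 - i)%N <= - 1 - Z.of_nat i)%Z.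
  elim: i => [|i IH] h; first by rewrite subn0; lia.
  have := inc (n.-1 - i.+1)%N; have -> : (n.-1 - i.+1).+1 = (n.-1 - i)%N by lia.
  by have := IH (ltnW h); lia.
have := lo k lkn; have := hi (n.-1 - k)%N.
have -> : (n.-1 - (n.-1 - k) = k)%N by lia.
by lia.
Qed.

Lemma generic_wact (u : seq 'I_n) x : generic x -> generic (wact (refl n) u x).
Proof. by move=> g; elim: u => //= i u IH; exact: generic_refl. Qed.

Lemma wact_reflK (u : seq 'I_n) x : wact (refl n) (rev u) (wact (refl n) u x) = x.
Proof.
elim: u x => //= i u IH x; rewrite rev_cons -cats1 wact_cat /=.
by rewrite reflK IH.
Qed.

Lemma pot_refl i x : i < n -> desc n i x -> (pot n (refl n i x) < pot n x)%Z.
Proof.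
move=> lin d; have [] := bsort_pot (refl n i x) lin.
rewrite bsort_refl; last exact: desc_refl.
rewrite reflK => le eq; have ne : pot n (refl n i x) <> pot n x.
  by move/eq => e; move: (desc_refl d); rewrite -e d.
by lia.
Qed.

Lemma pot_generic x : generic x ->
  (psum (fun k => Z.of_nat (n - k) * - Z.of_nat n)%Z n <= pot n x)%Z.
Proof. by case=> g1 _ _; apply: psum_le => k /g1; nia. Qed.

(* Every letter, read from the right, is an ascent of the word reached so far; this
   is equivalent to u being reduced, see reduced_dred. *)
Fixpoint dred (u : seq 'I_n) : bool :=
  if u is i :: u' then dred u' && ~~ desc n i (wact (refl n) u' base) else true.

(** Stripping descents lowers the potential, which is bounded below on generic words; the process
    can stop only at [base]. *)
Lemma dred_exists x : generic x -> exists2 u, dred u & wact (refl n) u base = x.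
Proof.
move=> g; have lb := pot_generic g.
have [N leN] : exists N, (pot n x <=
    psum (fun k => Z.of_nat (n - k) * - Z.of_nat n)%Z n + Z.of_nat N)%Z.
  by exists (Z.to_nat (pot n x - psum (fun k => Z.of_nat (n - k) * - Z.of_nat n)%Z n)); lia.
elim: N x g leN {lb} => [|N IH] x g leN.
  exists [::] => //=; apply/esym/generic_min => // i lin; apply/negP => d.
  by have := pot_refl lin d; have := pot_generic (generic_refl lin g); lia.
have [/existsP[i d]|/existsPn nd] := boolP [exists i : 'I_n, desc n i x].
  have [||u du e] := IH (refl n i x); first exact: generic_refl.
    by have := pot_refl (ltn_ord i) d; lia.
  by exists (i :: u); rewrite /= ?e ?du ?desc_refl // reflK.
exists [::] => //=; apply/esym/generic_min => // i lin.
exact: (nd (Ordinal lin)).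
Qed.

Fixpoint down (u : seq 'I_n) x : bool :=
  if u is i :: u' then desc n i x && down u' (refl n i x) else true.

Lemma down_dred u t x : down u x -> dred t ->
  wact (refl n) t base = wact (refl n) (rev u) x ->
  dred (u ++ t) /\ wact (refl n) (u ++ t) base = x.
Proof.
elim: u x => //= i u IH x /andP[d du] dt.
rewrite rev_cons -cats1 wact_cat /= => e.
have [-> ->] := IH _ du dt e.
by rewrite desc_refl // reflK.
Qed.

(** Two simultaneous descents allow the longest element of their dihedral subgroup to be stripped;
    exchanging i and j gives its other reduced word. *)
Lemma two_desc_down (i j : 'I_n) x : i != j -> desc n i x -> desc n j x ->
  down (alternating i j (coxB n i j)) x.
Proof.
move=> hij; have [lij|lji|e] := ltngtP i j.
- have [[-> h]|[-> [h1 h2]]|[-> [h1 h2]]] := coxB_cases lij;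
  rewrite /alternating /mkseq /= /desc /refl ?h1 ?h2.
  + by case: (eqVneq j.+1 n) => [e|ne]; at_point.
  + by at_point.
  + by at_point.
- have -> : coxB n i j = coxB n j i := coxB_mC i j.
  have [[-> h]|[-> [h1 h2]]|[-> [h1 h2]]] := coxB_cases lji;
  rewrite /alternating /mkseq /= /desc /refl ?h1 ?h2.
  + by case: (eqVneq i.+1 n) => [e|ne]; at_point.
  + by at_point.
  + by at_point.
- by move: hij; rewrite (val_inj e) eqxx.
Qed.

Lemma alternatingS (T : Type) (i j : T) m :
  alternating i j m.+1 = i :: alternating j i m.
Proof.
rewrite /alternating /mkseq /= -[1%N]addn0 iotaDl -map_comp; congr (_ :: _).
by apply: eq_map => k /=; case: (odd k).
Qed.

Inductive braid_rel : seq 'I_n -> seq 'I_n -> Prop :=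
| Braid i j : i != j ->
    braid_rel (alternating i j (coxB n i j)) (alternating j i (coxB n i j)).

Definition braid := pres_cong braid_rel.

Lemma braid_size u v : braid u v -> size u = size v.
Proof.
elim=> // {u v} [u v w _ -> _ //|u a b v [i j _]].
by rewrite !size_cat !size_mkseq.
Qed.

Lemma coxB_gt0 (i j : 'I_n) : 0 < coxB n i j.
Proof. by rewrite /= /coxB_m; do 3?case: ifP. Qed.

(* If u and v start with different letters i and j, both are descents of the common
   image, which therefore also has reduced words starting with either full braid
   word on i and j. *)
Lemma matsumoto u v : dred u -> dred v ->
  wact (refl n) u base = wact (refl n) v base -> braid u v.
Proof.
have [N] := ubnP (size u); elim: N u v => // N IH [|i u] [|j v] /= sz.
- by move=> *; exact: pres_refl.
- move=> _ /andP[dv ndj] e.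
  have := generic_desc_refl (ltn_ord j) (generic_wact v generic_base) ndj.
  by rewrite -e (negbTE (desc_base (ltn_ord j))).
- move=> /andP[dv ndj] _ e.
  have := generic_desc_refl (ltn_ord i) (generic_wact u generic_base) ndj.
  by rewrite e (negbTE (desc_base (ltn_ord i))).
move=> /andP[du ndi] /andP[dv ndj] e.
have [eij|hij] := eqVneq i j.
  subst j; apply: (pres_cong_catl [:: i]); apply: IH => //.
  by rewrite -[LHS](reflK n i) e reflK.
have di := generic_desc_refl (ltn_ord i) (generic_wact u generic_base) ndi.
have dj := generic_desc_refl (ltn_ord j) (generic_wact v generic_base) ndj.
move: (du) (dv) => /= _ _; set x := refl n i _ in e di.
rewrite -e in dj.
have dij := two_desc_down hij di dj.
have hji : j != i by rewrite eq_sym.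
have dji := two_desc_down hji dj di.
have mC : coxB n j i = coxB n i j := coxB_mC j i.
rewrite mC in dji.
have gx : generic x by apply: generic_refl (generic_wact u generic_base).
(* A reduced word for what remains after stripping the dihedral part. By [refl_braid] the remainder
   is the same for both braid words, so one [t] completes both. *)
have [t dt et] := dred_exists (generic_wact (rev (alternating i j (coxB n i j))) gx).
have et' : wact (refl n) t base =
    wact (refl n) (rev (alternating j i (coxB n i j))) x.
  rewrite et; set A := alternating i j _; set B := alternating j i _.
  rewrite -[LHS](wact_reflK (rev (rev B))) !revK.
  by rewrite -[in LHS](refl_braid _ hij) -/A -[in X in wact _ X (wact _ _ x)](revK A) wact_reflK.
have [rA eA] := down_dred dij dt et.
have [rB eB] := down_dred dji dt et'.
have [m em] : exists m, coxB n i j = m.+1.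
  by exists (coxB n i j).-1; rewrite prednK // coxB_gt0.
have stepAB : braid (alternating i j m.+1 ++ t) (alternating j i m.+1 ++ t).
  have := pres_step [::] t (Braid hij); rewrite !cat0s em; exact.
move: rA eA rB eB; rewrite em !alternatingS /= => /andP[rA _] eA /andP[rB _] eB.
have bA : braid u (alternating j i m ++ t).
  apply: IH => //; apply: (can_inj (reflK n i)); exact: esym.
(* [bA] preserves length, which supplies the bound for this second use of the induction
   hypothesis. *)
have bB : braid (alternating i j m ++ t) v.
  apply: IH => //; last by apply: (can_inj (reflK n j)); rewrite eB.
  move: (braid_size bA) sz; rewrite !size_cat !size_mkseq => <-.
  by rewrite ltnS.
apply: pres_trans (pres_cong_catl [:: i] bA) _.
move: stepAB; rewrite !alternatingS => /pres_trans; apply.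
exact: (pres_cong_catl [:: j] bB).
Qed.

End Generic.

(** * The Hecke monoid of type B *)

Section Words.
Variable n : nat.
Notation M := (coxB n).
Implicit Types (u v t : seq 'I_n) (J : {set 'I_n}).

Lemma braid_hecke u v : braid u v -> hecke_word M u = hecke_word M v.
Proof.
move=> h; apply/pres_wordP; elim: h => {u v}.
- exact: pres_refl.
- by move=> u v _; exact: pres_sym.
- by move=> u v w _ h1 _; exact: pres_trans.
- by move=> u a b v [i j hij]; apply: pres_step; exact: HeckeBraid.
Qed.

(** Reversing a word inverts it, so the braid relation is the Coxeter relation for (i j)^m with half
    of its letters moved to the other side. *)
Lemma cox_word_braid (i j : 'I_n) : i != j ->
  cox_word M (alternating i j (M i j)) = cox_word M (alternating j i (M i j)).
Proof.
move=> hij.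
apply: (@mulIg _ (cox_word M (rev (alternating j i (M i j))))).
have := cox_word_rev M (rev (alternating j i (M i j))); rewrite revK => ->.
rewrite -cox_word_cat.
suff -> : alternating i j (M i j) ++ rev (alternating j i (M i j)) =
    flatten (nseq (M i j) [:: i; j]).
  by apply/pres_wordP; have := pres_step [::] [::] (CoxRel M i j); rewrite cats0.
rewrite /=; have : coxB_m i j \in [:: 2; 3; 4].
  by rewrite /coxB_m (negbTE hij); case: ifP => // _; case: ifP.
by rewrite !inE => /or3P[] /eqP ->.
Qed.

Lemma braid_cox u v : braid u v -> cox_word M u = cox_word M v.
Proof.
elim=> // {u v} [u v w _ -> _ //|u a b v [i j hij]].
by rewrite !cox_word_cat cox_word_braid.
Qed.

Lemma alternating_mem (i j : 'I_n) m : 1 < m ->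
  alternating i j m =i [:: i; j].
Proof.
case: m => [|[|m]] // _ k; rewrite !alternatingS !inE orbA.
have [//|nij] := boolP ((k == i) || (k == j)).
apply/negbTE/negP => /mapP[l _ e]; move: nij; rewrite e.
by case: (odd l); rewrite eqxx ?orbT.
Qed.

(** Both sides of every defining relation use the same letters. *)
Lemma hecke_word_mem u v : hecke_word M u = hecke_word M v -> u =i v.
Proof.
move=> /pres_wordP; elim=> {u v} //.
- by move=> u v _ h k; rewrite h.
- by move=> u v w _ h1 _ h2 k; rewrite h1 h2.
- move=> u a b v h k; rewrite !mem_cat; congr (_ || (_ || _)).
  case: h => [i|i j hij]; first by rewrite !inE orbb.
  have gt1 : 1 < M i j.
    by rewrite /= /coxB_m (negbTE hij); case: ifP => // _; case: ifP.
  by rewrite !alternating_mem // !inE orbC.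
Qed.

Notation act := (wact (refl n)).

(** The exchange property: braid moves alone bring a descent to the front. *)
Lemma dred_step v (i : 'I_n) : dred v -> desc n i (act v (base n)) ->
  exists2 t, dred (i :: t) & braid v (i :: t).
Proof.
move=> dv d; have gv := generic_wact v (generic_base n).
have [t dt et] := dred_exists (generic_refl (ltn_ord i) gv).
have dit : dred (i :: t) by rewrite /= dt et desc_refl.
by exists t => //; apply: matsumoto => //=; rewrite et reflK.
Qed.

Lemma hecke_gen2 (i : 'I_n) : hecke_gen M i * hecke_gen M i = hecke_gen M i.
Proof.
rewrite -[LHS]pres_word_cat; apply/pres_wordP.
exact: (pres_step [::] [::] (HeckeIdem M i)).
Qed.

Lemma hecke_word_cons (i : 'I_n) u :
  hecke_word M (i :: u) = hecke_gen M i * hecke_word M u.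
Proof. exact: (pres_word_cat _ [:: i] u). Qed.

Lemma hecke_dred u : exists2 v, dred v & hecke_word M v = hecke_word M u.
Proof.
elim: u => [|i u [v dv ev]]; first by exists [::].
have [d|nd] := boolP (desc n i (act v (base n))); last first.
  by exists (i :: v); rewrite /= ?dv // !hecke_word_cons ev.
have [t dt bt] := dred_step dv d; exists v => //.
rewrite hecke_word_cons -ev (braid_hecke bt) hecke_word_cons.
by rewrite mulgA hecke_gen2.
Qed.

(** By the last clause a word not made of ascents has a strictly shorter equivalent; this is what
    identifies [dred] with minimal length. *)
Lemma cox_dred u : exists v,
  [/\ dred v, cox_word M v = cox_word M u, {subset v <= u} &
      (size v < size u) || dred u].
Proof.
elim: u => [|i u [v [dv ev sv szv]]]; first by exists [::].
have cc k w : cox_word M (k :: w) = cox_gen M k * cox_word M w.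
  exact: (pres_word_cat _ [:: k] w).
have [d|nd] := boolP (desc n i (act v (base n))); last first.
  have eact : act v (base n) = act u (base n).
    by apply: refl_cox_cong; apply/pres_wordP.
  exists (i :: v); split => /=.
  - by rewrite dv.
  - by rewrite !cc ev.
  - by move=> k; rewrite !inE => /orP[->//|/sv ->]; rewrite orbT.
  - by rewrite ltnS -eact nd andbT.
have [t dt bt] := dred_step dv d; exists t; split.
- by move: dt => /= /andP[].
- rewrite cc -ev (braid_cox bt) cc mulgA -[_ * cox_gen M i]cox_word_cat.
  by rewrite cox_gen2 mul1g.
- move=> k kt; rewrite inE; apply/orP; right; apply: sv.
  by rewrite (hecke_word_mem (braid_hecke bt)) inE kt orbT.
- have := braid_size bt; case/orP: szv => /=; first by lia.
  move=> du; have e : act u (base n) = act v (base n).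
    by apply: refl_cox_cong; apply/pres_wordP.
  by have := braid_size (matsumoto du dv e); lia.
Qed.

Lemma cox_word_act u v :
  cox_word M u = cox_word M v -> act u (base n) = act v (base n).
Proof. by move=> /pres_wordP h; exact: refl_cox_cong. Qed.

Lemma cox_length_dred u : dred u -> cox_length (cox_word M u) = size u.
Proof.
move=> du; rewrite /cox_length; case: ex_minnP => m /asboolP[v <- ev] hmin.
apply/eqP; rewrite eqn_leq hmin /=; last by apply/asboolP; exists u.
have [t [dt et _ sz]] := cox_dred v.
have bu : braid u t by apply: matsumoto => //; apply: cox_word_act; rewrite et.
rewrite (braid_size bu); case/orP: sz => [/ltnW //|dv].
by rewrite (braid_size (matsumoto dt dv (cox_word_act et))).
Qed.

Lemma reduced_dred u : reduced M u = dred u.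
Proof.
apply/idP/idP => [/eqP su|du]; last by rewrite /reduced cox_length_dred.
have [t [dt et _ /orP[sz|//]]] := cox_dred u.
by move: sz; rewrite su -et cox_length_dred // ltnn.
Qed.

Lemma hecke_of_cox_dred u : dred u ->
  hecke_of_cox (cox_word M u) = hecke_word M u.
Proof.
move=> du; rewrite /hecke_of_cox.
case: xgetP => [v _ [rv ev]|/(_ u)]; last first.
  by case; split=> //=; rewrite reduced_dred.
rewrite reduced_dred in rv.
by apply: braid_hecke; apply: matsumoto => //; exact: cox_word_act.
Qed.

Lemma parabolicP J (w : coxeter M) :
  parabolic J w <-> exists2 u, {subset u <= J} & cox_word M u = w.
Proof.
split.
  move=> h; apply: (h [set z | exists2 u, {subset u <= J} & cox_word M u = z]%classic).
  split; first split.
  - by exists [::].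
  - move=> _ _ [u su <-] [v sv <-]; exists (u ++ v); last exact: cox_word_cat.
    by move=> k; rewrite mem_cat => /orP[/su|/sv].
  - move=> _ [u su <-]; exists (rev u); first by move=> k; rewrite mem_rev => /su.
    by apply: (@mulIg _ (cox_word M u)); rewrite cox_word_rev mulVg.
  - move=> _ [j jJ <-]; exists [:: j] => // k; rewrite inE => /eqP ->; exact: jJ.
case=> u su <- S [[S1 SM SV] gS].
elim: u su => [|i u IH] su; first exact: S1.
rewrite -cat1s cox_word_cat; apply: SM.
  by apply: gS; exists i => //=; apply: su; rewrite inE eqxx.
by apply: IH => k ku; apply: su; rewrite inE ku orbT.
Qed.

Lemma hecke_parabolicP J (z : hecke M) :
  hecke_parabolic M J z <-> exists2 u, {subset u <= J} & hecke_word M u = z.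
Proof.
split.
  case=> w /parabolicP[u su <-] <-.
  have [v [dv ev sv _]] := cox_dred u.
  by exists v; [move=> k /sv/su|rewrite -ev hecke_of_cox_dred].
case=> u su <-; have [v dv ev] := hecke_dred u.
exists (cox_word M v); last by rewrite hecke_of_cox_dred.
apply/parabolicP; exists v => // k; rewrite (hecke_word_mem ev); exact: su.
Qed.

Lemma hecke_wordP (z : hecke M) : exists u, hecke_word M u = z.
Proof. by exists (repr z); exact: pres_reprK. Qed.

Lemma hecke_supp_word u : hecke_supp (hecke_word M u) = [set i in u]%SET.
Proof.
apply/setP => i; rewrite !inE; apply/asboolP/idP.
  by case=> v [_ /hecke_word_mem ev]; rewrite ev.
move=> iu; have [v dv ev] := hecke_dred u; exists v.
by rewrite reduced_dred (hecke_word_mem ev).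
Qed.

Definition hact (z : hecke M) := wact (bsort n) (repr z).

Lemma hact_word u x : hact (hecke_word M u) x = wact (bsort n) u x.
Proof.
apply: wact_hecke_cong; apply/pres_wordP; exact: pres_reprK.
Qed.

Lemma hactM z1 z2 x : hact (z1 * z2) x = hact z1 (hact z2 x).
Proof.
have [u <-] := hecke_wordP z1; have [v <-] := hecke_wordP z2.
by rewrite -[_ * _]pres_word_cat !hact_word wact_cat.
Qed.

Lemma hact_gen (i : 'I_n) x : hact (hecke_gen M i) x = bsort n i x.
Proof. exact: (hact_word [:: i]). Qed.

Lemma wact_dred u : dred u -> wact (bsort n) u (base n) = act u (base n).
Proof.
by elim: u => //= i u IH /andP[du nd]; rewrite IH // bsort_refl.
Qed.

(** On words of ascents the sorting action at [base] coincides with the reflection action, to which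
    [matsumoto] applies. *)
Lemma hact_inj z1 z2 : hact z1 (base n) = hact z2 (base n) -> z1 = z2.
Proof.
have [u <-] := hecke_wordP z1; have [v <-] := hecke_wordP z2.
have [u' du <-] := hecke_dred u; have [v' dv <-] := hecke_dred v.
rewrite !hact_word !wact_dred // => e.
by apply: braid_hecke; exact: matsumoto.
Qed.

(** Describes the longest element by multiplication alone: [hecke_longestP] gives existence and
    [absorbs_inj] uniqueness. *)
Definition absorbs J (z : hecke M) :=
  (exists2 u, {subset u <= J} & hecke_word M u = z) /\
  (forall j, j \in J -> hecke_gen M j * z = z).

Lemma absorbs_word J z u : absorbs J z -> {subset u <= J} -> hecke_word M u * z = z.
Proof.
move=> [_ h]; elim: u => [|i u IH] su; first exact: mul1g.
rewrite hecke_word_cons -mulgA IH ?h //; last by move=> k ku; apply: su; rewrite inE ku orbT.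
by apply: su; rewrite inE eqxx.
Qed.

(** Reversal is an anti-automorphism: braid words of odd length are palindromes, and the two of even
    length are exchanged. *)
Lemma hecke_word_rev u v : hecke_word M u = hecke_word M v ->
  hecke_word M (rev u) = hecke_word M (rev v).
Proof.
move=> /pres_wordP h; apply/pres_wordP; elim: h => {u v}.
- by move=> u; exact: pres_refl.
- by move=> u v _; exact: pres_sym.
- by move=> u v w _ h1 _; exact: pres_trans.
move=> u a b v h; rewrite !rev_cat -!catA.
apply: pres_cong_catl; apply: pres_cong_catr.
have step c d : hecke_rel M c d -> pres_cong (hecke_rel M) c d.
  by move=> /(pres_step [::] [::]); rewrite !cats0.
case: h => [i|i j hij]; first exact: (step _ _ (HeckeIdem M i)).
have := step _ _ (HeckeBraid M hij); have : M i j \in [:: 2; 3; 4].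
  by rewrite /= /coxB_m (negbTE hij); case: ifP => // _; case: ifP.
rewrite !inE => /or3P[] /eqP -> //; exact: pres_sym.
Qed.

Lemma absorbs_sub J u : absorbs J (hecke_word M u) -> {subset u <= J}.
Proof. by move=> [[v sv /hecke_word_mem ev] _] k; rewrite -ev => /sv. Qed.

(* The product (rev v) u equals u because u absorbs J on the left, and equals rev v
   because rev v absorbs J on the right. *)
Lemma absorbs_rev J u v : absorbs J (hecke_word M u) -> absorbs J (hecke_word M v) ->
  hecke_word M u = hecke_word M (rev v).
Proof.
move=> au av; have srv : {subset rev v <= J}.
  by move=> k; rewrite mem_rev; exact: (absorbs_sub av).
have sru : {subset rev u <= J} by move=> k; rewrite mem_rev; exact: (absorbs_sub au).
rewrite -(absorbs_word au srv) -[LHS]pres_word_cat.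
have := hecke_word_rev (v := v) (u := rev u ++ v).
rewrite rev_cat revK; apply.
exact: etrans (pres_word_cat _ _ _) (absorbs_word av sru).
Qed.

Lemma absorbs_inj J z z' : absorbs J z -> absorbs J z' -> z = z'.
Proof.
move=> az az'; have [[u su eu] _] := az; have [[v sv ev] _] := az'.
move: az az'; rewrite -eu -ev => au av.
by rewrite (absorbs_rev au av) -(absorbs_rev av av).
Qed.

Lemma absorbs_wordr J z u : absorbs J z -> {subset u <= J} -> z * hecke_word M u = z.
Proof.
move=> az su; have [[v _ ev] _] := az.
have sru : {subset rev u <= J} by move=> k; rewrite mem_rev => /su.
rewrite -ev in az *; have e := absorbs_rev az az.
have := absorbs_word az sru; rewrite {1}e -[LHS]pres_word_cat => /hecke_word_rev.
by rewrite rev_cat !revK -e => h; rewrite -[RHS]h; exact: esym (pres_word_cat _ _ _).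
Qed.

Lemma pot_generic_ub x : generic n x ->
  (pot n x <= psum (fun k => Z.of_nat (n - k) * Z.of_nat n)%Z n)%Z.
Proof. by case=> g1 _ _; apply: psum_le => k /g1; nia. Qed.

Lemma dred_pot u : dred u ->
  (Z.of_nat (size u) + pot n (base n) <= pot n (act u (base n)))%Z.
Proof.
elim: u => [|i u IH]; first by move=> _; apply: Z.le_refl.
case/andP=> /IH le nd; have g := generic_wact u (generic_base n).
have := pot_refl (ltn_ord i) (generic_desc_refl (ltn_ord i) g nd).
rewrite reflK -[size (i :: u)]/(size u).+1.
by rewrite -[act (i :: u) _]/(refl n i (act u (base n))); lia.
Qed.

(** Each letter of a reduced word raises the potential by at least one, and the potential is bounded
    above on generic words, so lengths are bounded. *)
Lemma longest_exists J : exists w : coxeter M, is_longest J w.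
Proof.
pose P k := `[< exists2 w : coxeter M, parabolic J w & cox_length w = k >].
have exP : exists k, P k.
  exists (cox_length (1 : coxeter M)); apply/asboolP; exists 1 => //.
  by apply/parabolicP; exists [::].
pose N := Z.to_nat (psum (fun k => Z.of_nat (n - k) * Z.of_nat n)%Z n - pot n (base n)).
have ubP k : P k -> k <= N.
  move=> /asboolP[w _ <-]; rewrite -(pres_reprK w) -/(cox_word M _).
  have [v [dv <- _ _]] := cox_dred (repr w).
  rewrite cox_length_dred //; have := dred_pot dv.
  have := pot_generic_ub (generic_wact v (generic_base n)); rewrite /N; lia.
have [k /asboolP[w pw lw] maxk] := ex_maxnP exP ubP.
by exists w; split=> // v pv; rewrite lw; apply: maxk; apply/asboolP; exists v.
Qed.

Lemma hecke_longestP J : absorbs J (hecke_longest M J).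
Proof.
rewrite /hecke_longest /cox_longest; case: xgetP => [w _|]; last first.
  by have [w lw] := longest_exists J => /(_ w).
case=> pw maxw; have [u su ew] := (parabolicP J w).1 pw.
have [v [dv ev sv _]] := cox_dred u.
rewrite -ew -ev hecke_of_cox_dred //; split.
  by exists v => // k /sv/su.
move=> j jJ; apply: hact_inj; rewrite hactM hact_gen !hact_word wact_dred //.
(* If [j] were an ascent, [j :: v] would be a longer reduced word in the same parabolic subgroup. *)
apply/bsort_id/desc_sorted; apply: contraT => nd.
have dv' : dred (j :: v) by rewrite /= dv.
have := maxw (cox_word M (j :: v)); rewrite -ew -ev !cox_length_dred //= ltnn.
apply; apply/parabolicP; exists (j :: v) => // k; rewrite inE => /orP[/eqP -> //|].
by move/sv/su.
Qed.

Lemma hecke_longest_mul2 J : hecke_longest M J * hecke_longest M J = hecke_longest M J.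
Proof.
have a := hecke_longestP J; have [[u su eu] _] := a.
by have := absorbs_word a su; rewrite eu.
Qed.

Lemma hecke_longest_mulC A B C :
  hecke_longest M A * hecke_longest M B = hecke_longest M C ->
  hecke_longest M B * hecke_longest M A = hecke_longest M C.
Proof.
have aA := hecke_longestP A; have aB := hecke_longestP B; have aC := hecke_longestP C.
have [[u _ eu] _] := aA; have [[v _ ev] _] := aB; have [[w _ ew] _] := aC.
rewrite -eu -ev -ew in aA aB aC *; rewrite -[LHS]pres_word_cat => /hecke_word_rev.
rewrite rev_cat -(absorbs_rev aC aC) => <-.
by rewrite (absorbs_rev aA aA) (absorbs_rev aB aB) -[LHS]pres_word_cat.
Qed.

Lemma hecke_suppM (z1 z2 : hecke M) : hecke_supp (z1 * z2) = (hecke_supp z1 :|: hecke_supp z2)%SET.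
Proof.
have [u <-] := hecke_wordP z1; have [v <-] := hecke_wordP z2.
rewrite -[_ * _]pres_word_cat !hecke_supp_word; apply/setP => k.
by rewrite !inE mem_cat.
Qed.

Lemma hecke_supp_longest J : hecke_supp (hecke_longest M J) = J.
Proof.
have [[u su eu] h] := hecke_longestP J; rewrite -eu hecke_supp_word.
apply/setP => j; rewrite inE; apply/idP/idP => [/su //|jJ].
have := h j jJ; rewrite -eu -hecke_word_cons => /hecke_word_mem <-.
by rewrite inE eqxx.
Qed.

(** An idempotent fixes its own image of [base]; by [wact_bsort_fix] so does every letter of its
    support, and faithfulness turns this into absorption. *)
Lemma idempotent_longest z : z * z = z -> z = hecke_longest M (hecke_supp z).
Proof.
move=> zz; apply: absorbs_inj (hecke_longestP _).
have [u eu] := hecke_wordP z; rewrite -eu hecke_supp_word; split.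
  by exists u => // k; rewrite inE.
move=> j; rewrite inE => ju; apply: hact_inj; rewrite hactM hact_gen !hact_word.
apply: (wact_bsort_fix (u := u)) ju.
by rewrite -!hact_word -hactM eu zz.
Qed.

End Words.

Lemma psum0 f : psum f 0 = 0%Z. Proof. by []. Qed.

Lemma psumS f j : psum f j.+1 = (psum f j + f j)%Z. Proof. by []. Qed.

Lemma psum_const f c i j : i <= j -> (forall k, i <= k < j -> f k = c) ->
  psum f j = (psum f i + c * Z.of_nat (j - i))%Z.
Proof.
elim: j => [|j IH] le h.
  have -> : i = 0%N by lia.
  by rewrite /=; lia.
have [e|ne] := eqVneq i j.+1; first by rewrite e subnn; lia.
rewrite /= IH ?h; [|lia|lia|by move=> k hk; apply: h; lia].
have -> : j.+1 - i = (j - i).+1 by lia.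
by lia.
Qed.

Lemma psum_step f i j : i <= j -> (forall k, 0 <= f k <= 1)%Z ->
  (0 <= psum f j - psum f i <= Z.of_nat (j - i))%Z.
Proof.
move=> le h; elim: j le => [|j IH] le.
  have -> : i = 0%N by lia.
  by rewrite /=; lia.
have [e|ne] := eqVneq i j.+1; first by rewrite e subnn; lia.
by have := h j; have := IH; rewrite /=; lia.
Qed.

(** Only the cut between two adjacent entries sees them separately. *)
Lemma psum_swap f g i k :
  (forall l, l < k -> l <> i -> l <> i.+1 -> f l = g l) ->
  (f i + f i.+1 = g i + g i.+1)%Z -> k <> i.+1 -> psum f k = psum g k.
Proof.
move=> h e nk; have [le|gt] := leqP k i.
  by apply: psum_eq => l hl; apply: h; lia.
have lt : i.+1 < k by lia.
pose f' l := if l < k then f l else g l.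
have h' l : l <> i -> l <> i.+1 -> f' l = g l.
  by rewrite /f'; case: ltnP => // lk; exact: h.
have e' : psum f' k = psum f k by apply: psum_eq => l; rewrite /f' => ->.
have := psum_eq2 lt h'; rewrite e' /f' lt (ltnW lt).
by lia.
Qed.

Lemma psum_indicator lo hi k : lo <= hi ->
  psum (fun j => if lo <= j < hi then 1%Z else 0%Z) k =
  Z.max 0 (Z.min (Z.of_nat k - Z.of_nat lo) (Z.of_nat hi - Z.of_nat lo)).
Proof. by move=> le; elim: k => [|k IH]; rewrite ?psum0 ?psumS ?IH; try case: ifP; lia. Qed.

(** * Block sorts *)

Section Paths.
Variable n : nat.
Notation M := (coxB n).
Implicit Types (u v : seq 'I_n).

(* The antisymmetric word of length 2n through which B_n is folded out of A_(2n-1). *)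
Definition dbl x (j : nat) : Z := if j < n then x j else (- x (2 * n - j.+1)%N)%Z.

Definition path x (t : Z) (k : nat) : Z :=
  psum (fun j => if (t <=? dbl x j)%Z then 1%Z else 0%Z) k.

Lemma path_step x t i j : i <= j ->
  (0 <= path x t j - path x t i <= Z.of_nat (j - i))%Z.
Proof. by move=> le; apply: psum_step => // k; case: ifP; lia. Qed.

(** In the doubled word a generator acts on two mirror pairs of neighbours, or on the central pair
    if i + 1 = n, so only the cuts inside these pairs can change. *)
Lemma path_bsort (i : nat) x t k : i < n -> k <> i.+1 -> k <> 2 * n - i.+1 ->
  k <= 2 * n -> path (bsort n i x) t k = path x t k.
Proof.
move=> lin k1 k2 k3; rewrite /path; have [e|ne] := eqVneq i.+1 n.
  apply: (psum_swap (i := i)) => [l l0 l1 l2||//]; last first.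
    rewrite /dbl lin e ltnn; have -> : (2 * n - n.+1)%N = i by lia.
    by rewrite /bsort e !eqxx; do 2!case: ifP; do 2!case: ifP; lia.
  rewrite /dbl /bsort e eqxx.
  have -> : (l == i) = false by lia.
  by case: ltnP => // h; case: eqP => // h'; lia.
(* Only the left half is sorted in [g], so that each side of it is one application of
   [psum_swap]. *)
pose g j := if j < n then dbl (bsort n i x) j else dbl x j.
transitivity (psum (fun j => if (t <=? g j)%Z then 1%Z else 0%Z) k).
  apply: (psum_swap (i := 2 * n - i.+2)) => [l l0 l1 l2||]; last by lia.
    rewrite /g /dbl /bsort (negbTE ne); case: ltnP => // h.
    have -> : (2 * n - l.+1 == i) = false by lia.
    by have -> : (2 * n - l.+1 == i.+1) = false by lia.
  rewrite /g /dbl.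
  have -> : (2 * n - i.+2 < n) = false by lia.
  have -> : ((2 * n - i.+2).+1 < n) = false by lia.
  have -> : (2 * n - (2 * n - i.+2).+1)%N = i.+1 by lia.
  have -> : (2 * n - (2 * n - i.+2).+2)%N = i by lia.
  rewrite /bsort (negbTE ne) !eqxx.
  have -> : (i.+1 == i) = false by lia.
  by do 2!case: ifP; do 2!case: ifP; lia.
apply: (psum_swap (i := i)) => [l l0 l1 l2||//].
  rewrite /g /dbl /bsort (negbTE ne).
  have -> : (l == i) = false by lia.
  have -> : (l == i.+1) = false by lia.
  by case: ltnP.
rewrite /g /dbl lin; have -> : i.+1 < n by lia.
rewrite /bsort (negbTE ne) !eqxx.
have -> : (i.+1 == i) = false by lia.
by do 2!case: ifP; do 2!case: ifP; lia.
Qed.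

Lemma sorted_at_dbl i x : i < n ->
  sorted_at n i x = (dbl x i.+1 <=? dbl x i)%Z.
Proof.
move=> lin; rewrite /sorted_at /dbl lin; case: eqP => [e|ne].
  rewrite e ltnn (_ : (2 * n - n.+1)%N = i); lia.
by have -> : i.+1 < n by lia.
Qed.

Lemma sorted_at_dbl_mirror i x : i.+1 < n ->
  sorted_at n i x = (dbl x (2 * n - i.+1) <=? dbl x (2 * n - i.+2))%Z.
Proof.
move=> lin; rewrite /sorted_at /dbl.
have -> : (i.+1 == n) = false by lia.
have -> : (2 * n - i.+2 < n) = false by lia.
have -> : (2 * n - i.+1 < n) = false by lia.
have -> : (2 * n - (2 * n - i.+2).+1)%N = i.+1 by lia.
have -> : (2 * n - (2 * n - i.+1).+1)%N = i by lia.
by lia.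
Qed.

(** In a decreasing stretch the letters that reach t come first: the count climbs with slope one and
    then stays at its final value. *)
Lemma path_sorted x t lo hi k : (forall j, lo <= j -> j.+1 < hi ->
    (dbl x j.+1 <= dbl x j)%Z) -> lo <= k <= hi ->
  path x t k = Z.min (path x t lo + Z.of_nat (k - lo)) (path x t hi).
Proof.
move=> s lek.
have mono i j : lo <= i <= j -> j < hi -> (dbl x j <= dbl x i)%Z.
  elim: j => [|j IH] h1 h2; first by rewrite (_ : i = 0%N); lia.
  have [e|ne] := eqVneq i j.+1; first by rewrite e; lia.
  by have := IH; have := s j; lia.
have [e|lt] := eqVneq k lo.
  rewrite e; have := @path_step x t lo hi; lia.
have s1 := @path_step x t lo k; have s2 := @path_step x t k hi.
have [h|h] := boolP (t <=? dbl x k.-1)%Z.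
  have e : path x t k = (path x t lo + 1 * Z.of_nat (k - lo))%Z.
    apply: psum_const; first by lia.
    move=> j hj; have := mono j k.-1; case: ifP; lia.
  by lia.
have e : path x t hi = (path x t k + 0 * Z.of_nat (hi - k))%Z.
  apply: psum_const; first by lia.
  by move=> j hj; have := mono k.-1 j; case: ifP; lia.
by lia.
Qed.

(** The threshold at the second letter detects a strict ascent, since then the second letter reaches
    it and the first does not. *)
Lemma path_sorted_at x i : i < n ->
  (forall t, (Z.min (path x t i + 1) (path x t i.+2) <= path x t i.+1)%Z) ->
  sorted_at n i x.
Proof.
move=> lin h; rewrite sorted_at_dbl //; have := h (dbl x i.+1).
by rewrite /path /=; do 2!case: ifP; lia.
Qed.

(* The vertices a, ..., b - 1, counted from 0: W a b sorts the positions [a, b] if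
   b < n, and the positions [a, 2n - a) of the doubled word if b = n. *)
Definition W (a b : nat) : hecke M := hecke_longest M (interval n a.+1 b).

Lemma mem_interval a b (i : 'I_n) : (i \in interval n a.+1 b) = (a <= i < b).
Proof. by rewrite inE. Qed.

Lemma W_sorted a b x (i : 'I_n) : a <= i < b -> sorted_at n i (hact (W a b) x).
Proof.
move=> h; apply: bsort_fix; rewrite -hact_gen -hactM.
by have [_ -> //] := hecke_longestP (interval n a.+1 b); rewrite mem_interval.
Qed.

Lemma path_word u x t k : k <= 2 * n ->
  (forall i, i \in u -> k <> i.+1 /\ k <> 2 * n - i.+1) ->
  path (wact (bsort n) u x) t k = path x t k.
Proof.
move=> lek; elim: u => //= i u IH h.
have [h1 h2] := h i (mem_head i u).
rewrite path_bsort // IH // => j ju; apply: h; rewrite inE ju orbT //.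
Qed.

Lemma W_path_out a b x t k : k <= 2 * n -> b <= n ->
  ~~ (a < k <= b) -> ~~ (2 * n - b <= k < 2 * n - a) ->
  path (hact (W a b) x) t k = path x t k.
Proof.
move=> lek bn h1 h2; have [[u su eu] _] := hecke_longestP (interval n a.+1 b).
rewrite /W -eu hact_word path_word // => i /su.
by rewrite mem_interval; have := ltn_ord i; lia.
Qed.

Lemma W_pathA a b x t k : a <= b < n -> a <= k <= b.+1 ->
  path (hact (W a b) x) t k =
  Z.min (path x t a + Z.of_nat (k - a)) (path x t b.+1).
Proof.
move=> hab hk; rewrite (@path_sorted _ t a b.+1 k) // ?W_path_out //; try lia.
move=> j h1 h2; have lj : j < n by lia.
have := @W_sorted a b x (Ordinal lj).
by rewrite /= sorted_at_dbl //; lia.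
Qed.

Lemma W_pathA_mirror a b x t k : a <= b < n ->
  2 * n - b.+1 <= k <= 2 * n - a ->
  path (hact (W a b) x) t k =
  Z.min (path x t (2 * n - b.+1) + Z.of_nat (k - (2 * n - b.+1)))
    (path x t (2 * n - a)).
Proof.
move=> hab hk; rewrite (@path_sorted _ t (2 * n - b.+1) (2 * n - a) k) //
  ?W_path_out //; try lia.
move=> j h1 h2; have lj : 2 * n - j.+2 < n by lia.
have := @W_sorted a b x (Ordinal lj).
rewrite /= sorted_at_dbl_mirror; last by lia.
have -> : 2 * n - (2 * n - j.+2).+1 = j.+1 by lia.
have -> : 2 * n - (2 * n - j.+2).+2 = j by lia.
by lia.
Qed.

Lemma W_pathB a x t k : a <= n -> a <= k <= 2 * n - a ->
  path (hact (W a n) x) t k =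
  Z.min (path x t a + Z.of_nat (k - a)) (path x t (2 * n - a)).
Proof.
move=> an hk; rewrite (@path_sorted _ t a (2 * n - a) k) // ?W_path_out //; try lia.
move=> j h1 h2; have [lj|lj] := ltnP j n.
  by have := @W_sorted a n x (Ordinal lj); rewrite /= sorted_at_dbl //; lia.
have lj' : 2 * n - j.+2 < n by lia.
have := @W_sorted a n x (Ordinal lj').
rewrite /= sorted_at_dbl_mirror; last by lia.
have -> : 2 * n - (2 * n - j.+2).+1 = j.+1 by lia.
have -> : 2 * n - (2 * n - j.+2).+2 = j by lia.
by lia.
Qed.

(** For b = n the cuts up to n + 1 suffice, because the last generator involves only the cuts n - 1,
    n and n + 1. *)
Lemma path_W z a b hi : b <= n -> (hi = if b == n then n.+1 else b.+1) ->
  (exists2 u, {subset u <= interval n a.+1 b} & hecke_word M u = z) ->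
  (forall x t k, a <= k <= hi -> path (hact z x) t k =
    Z.min (path (hact z x) t a + Z.of_nat (k - a)) (path (hact z x) t hi)) ->
  z = W a b.
Proof.
move=> bn ehi wz h; apply: absorbs_inj (hecke_longestP _); split=> // j.
rewrite mem_interval => hj; apply: hact_inj; rewrite hactM hact_gen.
apply/bsort_id/path_sorted_at => // t.
have hhi : j.+2 <= hi by rewrite ehi; have := ltn_ord j; case: eqP; lia.
by rewrite (h _ _ j) ?(h _ _ j.+1) ?(h _ _ j.+2); lia.
Qed.

(** Test words: at threshold 1 the letters 1 give a ramp over their own positions, the letters -1 a
    ramp over the mirror positions. *)
Definition block (s : Z) lo hi : nat -> Z := fun j => if lo <= j < hi then s else 0%Z.

Lemma path_pos lo hi k : lo <= hi <= n -> k <= 2 * n -> path (block 1 lo hi) 1 k =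
  Z.max 0 (Z.min (Z.of_nat k - Z.of_nat lo) (Z.of_nat hi - Z.of_nat lo)).
Proof.
move=> le lek; rewrite -psum_indicator; last by lia.
apply: psum_eq => j hj; rewrite /dbl /block; case: (ltnP j n) => h; first by do 3?case: ifP; lia.
by do 4?case: ifP; lia.
Qed.

Lemma path_neg lo hi k : lo <= hi <= n -> k <= 2 * n -> path (block (-1) lo hi) 1 k =
  Z.max 0 (Z.min (Z.of_nat k - Z.of_nat (2 * n - hi)) (Z.of_nat hi - Z.of_nat lo)).
Proof.
move=> le lek; transitivity (psum (fun j => if 2 * n - hi <= j < 2 * n - lo then 1%Z else 0%Z) k).
  apply: psum_eq => j hj; rewrite /dbl /block; case: (ltnP j n) => h; first by do 3?case: ifP; lia.
  by do 4?case: ifP; lia.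
by rewrite psum_indicator; lia.
Qed.

End Paths.

(** * Obstructions to relations between overlapping block sorts *)

Section Braids.
Variable n : nat.
Notation M := (coxB n).
Notation W := (@W n).
Notation path := (@path n).

Lemma W_path_in a b x t k : a <= b <= n ->
  let hi := if b == n then 2 * n - a else b.+1 in a <= k <= hi ->
  path (hact (W a b) x) t k = Z.min (path x t a + Z.of_nat (k - a)) (path x t hi).
Proof.
move=> hab /=; case: eqP => [e|ne] hk; first by subst b; apply: W_pathB; lia.
by apply: W_pathA; lia.
Qed.

Lemma W_overlap_comm a b c d : a < c <= b -> b < d <= n ->
  W a b * W c d <> W c d * W a b.
Proof.
move=> h1 h2 e.
(* A single 1 at doubled position b + 1, just right of the block of [W a b]; if b + 1 = n this
   position is the mirror of b. [W c d] carries it to c, and only afterwards can [W a b] carry it on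
   to a. *)
pose x := if b.+1 == n then block (-1) b n else block 1 b.+1 b.+2.
have px k : k <= 2 * n -> path x 1 k =
    Z.max 0 (Z.min 1 (Z.of_nat k - Z.of_nat b.+1)).
  move=> hk; rewrite /x; case: eqP => e'; rewrite ?path_neg ?path_pos; lia.
have := congr1 (fun z => path (hact z x) 1 a.+1) e; rewrite !hactM.
rewrite W_pathA; [|lia|lia].
rewrite W_path_out ?px; try lia.
pose hi := if d == n then 2 * n - c else d.+1.
have hhi : b.+1 < hi <= 2 * n by rewrite /hi; case: eqP; lia.
rewrite W_path_in -/hi ?px; try lia.
have e1 : path (hact (W a b) x) 1 a.+1 = 0%Z by rewrite W_pathA ?px; lia.
have -> : path (hact (W c d) (hact (W a b) x)) 1 a.+1 = 0%Z.
  have [ea|ne] := eqVneq c a.+1; last by rewrite W_path_out ?e1; lia.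
  rewrite W_path_in -/hi; try lia.
  by have := @path_step n (hact (W a b) x) 1 a.+1 hi; rewrite ea subnn e1; lia.
by lia.
Qed.

(* Each of the products below fails to be absorbing because of one explicit word,
   all of whose nonzero letters are equal and fill one block. *)
Section Necessary.
Variables a b c d : nat.
Hypotheses (hac : a < c <= b) (hbd : b < d <= n).
Notation J := (W a b).
Notation K := (W c d).

Section Top.
Hypothesis dn : d = n.

(** The mirror block of J is full of ones. K carries those within its reach to c, J carries these on
    towards a, and J acting on the mirror side brings further ones within reach of K. *)
Let x := block (-1) a b.+1.
Let px k : k <= 2 * n -> path x 1 k = Z.max 0
  (Z.min (Z.of_nat k - Z.of_nat (2 * n - b.+1)) (Z.of_nat b.+1 - Z.of_nat a)).
Proof. by move=> hk; rewrite path_neg; lia. Qed.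

Let y1 := hact J x.
Let y1_c : path y1 1 c = 0%Z.
Proof. by rewrite W_pathA ?px; lia. Qed.
Let y1_a : path y1 1 a = 0%Z.
Proof. by rewrite W_pathA ?px; lia. Qed.
Let y1_mc : path y1 1 (2 * n - c) = (Z.of_nat b.+1 - Z.of_nat c)%Z.
Proof. by rewrite W_pathA_mirror ?px; lia. Qed.
Let y1_ma : path y1 1 (2 * n - a) = (Z.of_nat b.+1 - Z.of_nat a)%Z.
Proof. by rewrite W_path_out ?px; lia. Qed.

Let y2 := hact K y1.
Let y2_in k : c <= k <= 2 * n - c -> path y2 1 k =
  Z.min (Z.of_nat k - Z.of_nat c) (Z.of_nat b.+1 - Z.of_nat c).
Proof. by move=> hk; rewrite /y2 dn W_pathB ?y1_c ?y1_mc; lia. Qed.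
Let y2_a : path y2 1 a = 0%Z.
Proof. by rewrite W_path_out ?y1_a; lia. Qed.
Let y2_ma : path y2 1 (2 * n - a) = (Z.of_nat b.+1 - Z.of_nat a)%Z.
Proof. by rewrite W_path_out ?y1_ma; lia. Qed.

Let y3 := hact J y2.
Let y3_in k : a <= k <= b.+1 -> path y3 1 k =
  Z.min (Z.of_nat k - Z.of_nat a) (Z.of_nat b.+1 - Z.of_nat c).
Proof. by move=> hk; rewrite W_pathA ?y2_a ?y2_in; lia. Qed.
Let y3_mc : path y3 1 (2 * n - c) = Z.min
  (2 * (Z.of_nat b.+1 - Z.of_nat c)) (Z.of_nat b.+1 - Z.of_nat a).
Proof. by rewrite W_pathA_mirror ?y2_ma ?y2_in; lia. Qed.

Lemma W_top_JKJ : K * (J * K * J) <> J * K * J.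
Proof.
move=> e; have := congr1 (fun z => path (hact z x) 1 b.+1) e.
rewrite !hactM -/y1 -/y2 -/y3 {1}dn W_pathB; try lia.
by rewrite y3_mc !y3_in; lia.
Qed.

Lemma W_top_JKJK : J * K * J * K = K * J * K * J -> c - a <= b.+1 - c.
Proof.
move=> e; have eJ : J * (K * J * K * J) = K * J * K * J.
  by rewrite -e !mulgA hecke_longest_mul2.
have := congr1 (fun z => path (hact z x) 1 c) eJ.
rewrite !hactM -/y1 -/y2 -/y3 W_pathA; try lia.
have -> : path (hact K y3) 1 a = 0%Z by rewrite W_path_out ?y3_in; lia.
by rewrite dn !W_pathB ?y3_mc ?y3_in; lia.
Qed.

End Top.

Lemma W_top_KJK : d = n -> J * (K * J * K) <> K * J * K.
Proof.
(* The ones fill the part of the mirror block of J out of reach of K. J brings some within reach, K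
   carries them to c, and a further J still moves them left. *)
move=> dn e; pose x := block (-1) a c.
have px k : k <= 2 * n -> path x 1 k = Z.max 0
    (Z.min (Z.of_nat k - Z.of_nat (2 * n - c)) (Z.of_nat c - Z.of_nat a)).
  by move=> hk; rewrite path_neg; lia.
pose y1 := hact K x.
have y1_in k : k <= 2 * n - c -> path y1 1 k = 0%Z.
  move=> hk; rewrite /y1 dn; have [h|h] := leqP c k; last by rewrite W_path_out ?px; lia.
  by rewrite W_pathB ?px; lia.
have y1_ma : path y1 1 (2 * n - a) = (Z.of_nat c - Z.of_nat a)%Z.
  by rewrite W_path_out ?px; lia.
pose y2 := hact J y1.
have y2_in k : a <= k <= b.+1 -> path y2 1 k = 0%Z.
  by move=> hk; rewrite W_pathA ?y1_in; lia.
have y2_mc : path y2 1 (2 * n - c) = Z.min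
    (Z.of_nat b.+1 - Z.of_nat c) (Z.of_nat c - Z.of_nat a).
  by rewrite W_pathA_mirror ?y1_ma ?y1_in; lia.
pose y3 := hact K y2.
have := congr1 (fun z => path (hact z x) 1 c) e.
rewrite !hactM -/y1 -/y2 -/y3 W_pathA; try lia.
have -> : path y3 1 a = 0%Z by rewrite W_path_out ?y2_in; lia.
have y3_in k : c <= k <= 2 * n - c -> path y3 1 k = Z.min (Z.of_nat k - Z.of_nat c)
    (Z.min (Z.of_nat b.+1 - Z.of_nat c) (Z.of_nat c - Z.of_nat a)).
  by move=> hk; rewrite /y3 dn W_pathB ?y2_mc ?y2_in; lia.
by rewrite !y3_in; lia.
Qed.

Lemma W_braid3 : J * K * J = K * J * K ->
  [/\ d < n, c - a <= b.+1 - c & d - b <= b.+1 - c].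
Proof.
move=> e.
have eK : K * (J * K * J) = J * K * J.
  by rewrite e !mulgA hecke_longest_mul2.
have eJ : J * (K * J * K) = K * J * K.
  by rewrite -e !mulgA hecke_longest_mul2.
have dn : d < n by case: (ltngtP d n) => // [|h]; [lia|case: (W_top_JKJ h eK)].
split=> //.
(* The ones fill the block of K. If c - a > b + 1 - c, those that J carries off do not fill the
   positions left of c, and once K has refilled the overlap another J moves more. *)
- pose x := block 1 c d.+1.
  have px k : k <= 2 * n -> path x 1 k = Z.max 0
      (Z.min (Z.of_nat k - Z.of_nat c) (Z.of_nat d.+1 - Z.of_nat c)).
    by move=> hk; rewrite path_pos; lia.
  pose y1 := hact K x.
  have y1_c : path y1 1 c = 0%Z by rewrite W_pathA ?px; lia.
  have y1_b : path y1 1 b.+1 = (Z.of_nat b.+1 - Z.of_nat c)%Z.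
    by rewrite W_pathA ?px; lia.
  have y1_a : path y1 1 a = 0%Z by rewrite W_path_out ?px; lia.
  have y1_d : path y1 1 d.+1 = (Z.of_nat d.+1 - Z.of_nat c)%Z.
    by rewrite W_path_out ?px; lia.
  pose y2 := hact J y1.
  have y2_in k : a <= k <= b.+1 -> path y2 1 k =
      Z.min (Z.of_nat k - Z.of_nat a) (Z.of_nat b.+1 - Z.of_nat c).
    by move=> hk; rewrite W_pathA ?y1_a ?y1_b; lia.
  have y2_d : path y2 1 d.+1 = (Z.of_nat d.+1 - Z.of_nat c)%Z.
    by rewrite W_path_out ?y1_d; lia.
  pose y3 := hact K y2.
  have := congr1 (fun z => path (hact z x) 1 c) eJ.
  rewrite !hactM -/y1 -/y2 -/y3 W_pathA; try lia.
  have -> : path y3 1 a = 0%Z by rewrite W_path_out ?y2_in; lia.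
  have y3_in k : c <= k <= d.+1 -> path y3 1 k = Z.min
      (Z.min (Z.of_nat (c - a)) (Z.of_nat b.+1 - Z.of_nat c) + Z.of_nat (k - c))
      (Z.of_nat d.+1 - Z.of_nat c).
    by move=> hk; rewrite W_pathA ?y2_d ?y2_in; lia.
  by rewrite !y3_in; lia.
(* The ones lie in the block of K to the right of J. If d - b > b + 1 - c, there are more of them
   than the overlap holds, and after JKJ a further K still moves some into it. *)
- pose x := block 1 b.+1 d.+1.
  have px k : k <= 2 * n -> path x 1 k = Z.max 0
      (Z.min (Z.of_nat k - Z.of_nat b.+1) (Z.of_nat d.+1 - Z.of_nat b.+1)).
    by move=> hk; rewrite path_pos; lia.
  pose y1 := hact J x.
  have y1_in k : a <= k <= b.+1 -> path y1 1 k = 0%Z.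
    by move=> hk; rewrite W_pathA ?px; lia.
  have y1_d : path y1 1 d.+1 = (Z.of_nat d.+1 - Z.of_nat b.+1)%Z.
    by rewrite W_path_out ?px; lia.
  pose y2 := hact K y1.
  have y2_in k : c <= k <= d.+1 -> path y2 1 k =
      Z.min (Z.of_nat k - Z.of_nat c) (Z.of_nat d.+1 - Z.of_nat b.+1).
    by move=> hk; rewrite W_pathA ?y1_d ?y1_in; lia.
  have y2_a : path y2 1 a = 0%Z by rewrite W_path_out ?y1_in; lia.
  pose y3 := hact J y2.
  have y3_in k : a <= k <= b.+1 -> path y3 1 k = Z.min (Z.of_nat k - Z.of_nat a)
      (path y2 1 b.+1).
    by move=> hk; rewrite W_pathA ?y2_a; lia.
  have y3_d : path y3 1 d.+1 = (Z.of_nat d.+1 - Z.of_nat b.+1)%Z.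
    by rewrite W_path_out ?y2_in; lia.
  have := congr1 (fun z => path (hact z x) 1 b.+1) eK.
  rewrite !hactM -/y1 -/y2 -/y3 W_pathA; try lia.
  by rewrite y3_d !y3_in ?y2_in; lia.
Qed.

End Necessary.

End Braids.

(** * Relations between block sorts with a large overlap *)

Lemma min_KJK A B D E u o : (A <= B <= D)%Z -> (D <= E)%Z -> (0 <= u <= o)%Z ->
  (Z.min (A + u) (Z.min (Z.min (A + u) B + o) (Z.min (D + o) E)) =
   Z.min (A + u) E)%Z.
Proof. lia. Qed.

Lemma min_KJK_mirror A B D E u o l : (A <= B)%Z -> (E <= D + u + o)%Z ->
  (D <= B + l - o)%Z -> (0 <= u <= o)%Z ->
  (Z.min (A + (u + l + o)) E <=
   Z.min (Z.min (Z.min (A + u) B + l) (Z.min (D + o) E) + o) E)%Z.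
Proof. lia. Qed.

Lemma min_JKJ A C F E u o l m : (A <= C)%Z -> (F <= E <= F + u)%Z ->
  (0 <= u <= o)%Z -> (o <= m <= l)%Z ->
  (Z.min (Z.min (A + u) (Z.min (C + o) F) + m) (Z.min (Z.min (C + l) F + o) E) =
   Z.min (A + (u + m)) E)%Z.
Proof. lia. Qed.

Section Sufficient.
Variable n : nat.
Notation M := (coxB n).
Notation W := (@W n).
Notation path := (@path n).

Definition word_in (S : {set 'I_n}) (z : hecke M) :=
  exists2 u, {subset u <= S} & hecke_word M u = z.

Lemma word_inM S z1 z2 : word_in S z1 -> word_in S z2 -> word_in S (z1 * z2).
Proof.
move=> [u su <-] [v sv <-]; exists (u ++ v); last exact: pres_word_cat.
by move=> k; rewrite mem_cat => /orP[/su|/sv].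
Qed.

Lemma word_in_sub (S T : {set 'I_n}) z : S \subset T -> word_in S z -> word_in T z.
Proof. by move=> /fintype.subsetP sST [u su <-]; exists u => // k /su/sST. Qed.

Lemma word_in_W a b a' b' : a' <= a -> b <= b' ->
  word_in (interval n a'.+1 b') (W a b).
Proof.
move=> ha hb; have [w _] := hecke_longestP (interval n a.+1 b).
by apply: word_in_sub w; apply/fintype.subsetP => k; rewrite !mem_interval; lia.
Qed.

Lemma hecke_gen_far (i j : 'I_n) : i.+1 < j ->
  hecke_gen M i * hecke_gen M j = hecke_gen M j * hecke_gen M i.
Proof.
move=> h; apply: hact_inj; rewrite !hactM !hact_gen bsort_far //.
by rewrite h ltn_ord.
Qed.

Lemma W_far a b c d : b < c -> W a b * W c d = W c d * W a b.
Proof.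
move=> bc; have [u su <-] := word_in_W (leqnn a) (leqnn b).
have [v sv <-] := word_in_W (leqnn c) (leqnn d).
elim: u su => [|i u IHu] su; first by rewrite [LHS]mul1g [RHS]mulg1.
rewrite hecke_word_cons -mulgA IHu; last by move=> k ku; apply: su; rewrite inE ku orbT.
rewrite !mulgA; congr (_ * _).
have {u su IHu} hi : a <= i < b by have := su i (mem_head i u); rewrite mem_interval.
elim: v sv => [|j v IHv] sv; first by rewrite [LHS]mulg1 [RHS]mul1g.
have hj : c <= j < d by have := sv j (mem_head j v); rewrite mem_interval.
rewrite hecke_word_cons mulgA hecke_gen_far; last by lia.
rewrite -!mulgA IHv // => k kv; apply: sv; rewrite inE kv orbT //.
Qed.

Section Pair.
Variables a b c d : nat.
Hypotheses (hac : a < c <= b) (hbd : b < d <= n) (huo : c - a <= b.+1 - c).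
Notation J := (W a b).
Notation K := (W c d).

(** Each side of the braid relation is identified separately with the longest element of the union,
    so the two sides are never compared directly. *)
Lemma W_braid3_JKJ : d < n -> d - b <= b.+1 - c -> J * K * J = W a d.
Proof.
move=> dn vo; apply: (path_W (hi := d.+1)).
- by lia.
- by have -> : (d == n) = false by lia.
- by do 2?apply: word_inM; apply: word_in_W; lia.
move=> x t; rewrite !hactM.
have s1 := @path_step n x t a c; have s2 := @path_step n x t c b.+1.
have s3 := @path_step n x t b.+1 d.+1.
set y1 := hact J x; set y2 := hact K y1; set y3 := hact J y2.
have y1_in k : a <= k <= b.+1 -> path y1 t k =
    Z.min (path x t a + Z.of_nat (k - a)) (path x t b.+1).
  by move=> hk; rewrite W_pathA; lia.
have y1_d : path y1 t d.+1 = path x t d.+1 by rewrite W_path_out; lia.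
have y2_in k : c <= k <= d.+1 -> path y2 t k =
    Z.min (path y1 t c + Z.of_nat (k - c)) (path x t d.+1).
  by move=> hk; rewrite W_pathA ?y1_d; lia.
have y2_a : path y2 t a = path x t a by rewrite W_path_out ?y1_in; lia.
have y3_in k : a <= k <= b.+1 -> path y3 t k =
    Z.min (path x t a + Z.of_nat (k - a)) (path y2 t b.+1).
  by move=> hk; rewrite W_pathA ?y2_a; lia.
have y3_out k : b.+1 <= k <= d.+1 -> path y3 t k = path y2 t k.
  by move=> hk; rewrite W_path_out; lia.
move=> k hk; rewrite (y3_out d.+1) ?(y3_in a) ?y2_in ?y1_in; try lia.
have [h|h] := leqP k b.+1; first by rewrite y3_in ?y2_in ?y1_in; lia.
by rewrite y3_out ?y2_in ?y1_in; lia.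
Qed.

Lemma W_braid3_KJK : d < n -> d - b <= b.+1 - c -> K * J * K = W a d.
Proof.
move=> dn vo; apply: (path_W (hi := d.+1)).
- by lia.
- by have -> : (d == n) = false by lia.
- by do 2?apply: word_inM; apply: word_in_W; lia.
move=> x t; rewrite !hactM.
have s1 := @path_step n x t a c; have s2 := @path_step n x t c b.+1.
have s3 := @path_step n x t b.+1 d.+1.
set y1 := hact K x; set y2 := hact J y1; set y3 := hact K y2.
have y1_in k : c <= k <= d.+1 -> path y1 t k =
    Z.min (path x t c + Z.of_nat (k - c)) (path x t d.+1).
  by move=> hk; rewrite W_pathA; lia.
have y1_a : path y1 t a = path x t a by rewrite W_path_out; lia.
have y2_in k : a <= k <= b.+1 -> path y2 t k =
    Z.min (path x t a + Z.of_nat (k - a)) (path y1 t b.+1).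
  by move=> hk; rewrite W_pathA ?y1_a; lia.
have y2_d : path y2 t d.+1 = path x t d.+1 by rewrite W_path_out ?y1_in; lia.
have y3_in k : c <= k <= d.+1 -> path y3 t k =
    Z.min (path y2 t c + Z.of_nat (k - c)) (path x t d.+1).
  by move=> hk; rewrite W_pathA ?y2_d; lia.
have y3_out k : a <= k <= c -> path y3 t k = path y2 t k.
  by move=> hk; rewrite W_path_out; lia.
move=> k hk; rewrite (y3_out a) ?(y3_in d.+1) ?y2_in ?y1_in; try lia.
have [h|h] := leqP k c; first by rewrite y3_out ?y2_in ?y1_in; lia.
by rewrite y3_in ?y2_in ?y1_in; lia.
Qed.

Lemma W_braid4_KJKJ : d = n -> K * J * K * J = W a n.
Proof.
move=> dn; apply: (path_W (hi := n.+1)).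
- by lia.
- by rewrite eqxx.
- by do 3?apply: word_inM; apply: word_in_W; lia.
move=> x t; rewrite !hactM.
set y1 := hact J x; set y2 := hact K y1; set y3 := hact J y2; set y4 := hact K y3.
have y1_in k : a <= k <= b.+1 -> path y1 t k =
    Z.min (path x t a + Z.of_nat (k - a)) (path x t b.+1).
  by move=> hk; rewrite W_pathA; lia.
have y1_mc : path y1 t (2 * n - c) =
    Z.min (path x t (2 * n - b.+1) + Z.of_nat (b.+1 - c)) (path x t (2 * n - a)).
  by rewrite W_pathA_mirror; lia.
have y1_ma : path y1 t (2 * n - a) = path x t (2 * n - a).
  by rewrite W_path_out; lia.
have y2_in k : c <= k <= 2 * n - c -> path y2 t k =
    Z.min (path y1 t c + Z.of_nat (k - c)) (path y1 t (2 * n - c)).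
  by move=> hk; rewrite /y2 dn W_pathB; lia.
have y1_a : path y1 t a = path x t a by rewrite W_path_out; lia.
have y2_a : path y2 t a = path x t a by rewrite W_path_out ?y1_a; lia.
have y2_ma : path y2 t (2 * n - a) = path x t (2 * n - a).
  by rewrite W_path_out ?y1_ma; lia.
have y3_in k : a <= k <= b.+1 -> path y3 t k =
    Z.min (path x t a + Z.of_nat (k - a)) (path y2 t b.+1).
  by move=> hk; rewrite W_pathA ?y2_a; lia.
have y3_mc : path y3 t (2 * n - c) =
    Z.min (path y2 t (2 * n - b.+1) + Z.of_nat (b.+1 - c)) (path x t (2 * n - a)).
  by rewrite W_pathA_mirror ?y2_ma; lia.
have y4_in k : c <= k <= 2 * n - c -> path y4 t k =
    Z.min (path y3 t c + Z.of_nat (k - c)) (path y3 t (2 * n - c)).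
  by move=> hk; rewrite /y4 dn W_pathB; lia.
have y4_out k : a <= k <= c -> path y4 t k = path y3 t k.
  by move=> hk; rewrite W_path_out; lia.
(* A, B, D, E of [min_KJK] are the counts of x at the cuts a, b + 1, 2n - b - 1, 2n - a, with u = c
   - a and o = b + 1 - c. *)
have y3_c : path y3 t c = Z.min (path x t a + Z.of_nat (c - a)) (path x t (2 * n - a)).
  rewrite y3_in ?y2_in ?y1_mc ?y1_in; try (clear -hac hbd; lia).
  have s1 := @path_step n x t a b.+1.
  have s2 := @path_step n x t b.+1 (2 * n - b.+1).
  have s3 := @path_step n x t (2 * n - b.+1) (2 * n - a).
  by apply: min_KJK; clear -s1 s2 s3 hac hbd huo; lia.
have y3_le : (path y3 t (2 * n - c) <= path x t (2 * n - a))%Z.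
  by rewrite y3_mc; exact: Z.le_min_r.
have y3_ge : (Z.min (path x t a + Z.of_nat (2 * n - c - a)) (path x t (2 * n - a))
    <= path y3 t (2 * n - c))%Z.
  have -> : Z.of_nat (2 * n - c - a) = (Z.of_nat (c - a) +
      Z.of_nat (2 * n - b.+1 - c) + Z.of_nat (b.+1 - c))%Z by clear -hac hbd; lia.
  rewrite y3_mc y2_in ?y1_mc ?y1_in; try (clear -hac hbd; lia).
  have s1 := @path_step n x t a b.+1.
  have s2 := @path_step n x t b.+1 (2 * n - b.+1).
  have s3 := @path_step n x t (2 * n - b.+1) (2 * n - a).
  by apply: min_KJK_mirror; clear -s1 s2 s3 hac hbd huo; lia.
(* Since c < n, this range contains the cut n + 1 required by [path_W]. *)
have y4_eq k : a <= k <= 2 * n - c -> path y4 t k =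
    Z.min (path x t a + Z.of_nat (k - a)) (path x t (2 * n - a)).
  move=> hk; have [h|h] := leqP c k; last first.
    rewrite y4_out; last by clear -hk h; lia.
    rewrite y3_in; last by clear -hk h hac; lia.
    move: y3_c; rewrite y3_in; last by clear -hac; lia.
    have le2 : (path y2 t b.+1 <= path x t (2 * n - a))%Z.
      by rewrite y2_in ?y1_mc; clear -hac hbd; lia.
    by clear -le2 hk h; lia.
  rewrite y4_in; last by clear -hk h; lia.
  by rewrite y3_c; clear -hk h hac y3_le y3_ge; lia.
by move=> k hk; rewrite !y4_eq; clear -hk hac hbd; lia.
Qed.

Lemma W_braid4_JKJK : d = n -> J * K * J * K = W a n.
Proof.
move=> dn; apply: (path_W (hi := n.+1)).
- by lia.
- by rewrite eqxx.
- by do 3?apply: word_inM; apply: word_in_W; lia.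
move=> x t; rewrite !hactM.
set y1 := hact K x; set y2 := hact J y1; set y3 := hact K y2; set y4 := hact J y3.
have y1_in k : c <= k <= 2 * n - c -> path y1 t k =
    Z.min (path x t c + Z.of_nat (k - c)) (path x t (2 * n - c)).
  by move=> hk; rewrite /y1 dn W_pathB; lia.
have y1_a : path y1 t a = path x t a by rewrite W_path_out; lia.
have y1_ma : path y1 t (2 * n - a) = path x t (2 * n - a).
  by rewrite W_path_out; lia.
have y2_in k : a <= k <= b.+1 -> path y2 t k =
    Z.min (path x t a + Z.of_nat (k - a)) (path y1 t b.+1).
  by move=> hk; rewrite W_pathA ?y1_a; lia.
have y2_mc : path y2 t (2 * n - c) =
    Z.min (path y1 t (2 * n - b.+1) + Z.of_nat (b.+1 - c)) (path x t (2 * n - a)).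
  by rewrite W_pathA_mirror ?y1_ma; lia.
have y2_ma : path y2 t (2 * n - a) = path x t (2 * n - a).
  by rewrite W_path_out ?y1_ma; lia.
have y3_in k : c <= k <= 2 * n - c -> path y3 t k =
    Z.min (path y2 t c + Z.of_nat (k - c)) (path y2 t (2 * n - c)).
  by move=> hk; rewrite /y3 dn W_pathB; lia.
have y2_a : path y2 t a = path x t a by rewrite W_path_out ?y1_a; lia.
have y3_a : path y3 t a = path x t a by rewrite W_path_out ?y2_a; lia.
have y4_in k : a <= k <= b.+1 -> path y4 t k =
    Z.min (path x t a + Z.of_nat (k - a)) (path y3 t b.+1).
  by move=> hk; rewrite W_pathA ?y3_a; lia.
have y4_out k : b.+1 <= k <= 2 * n - b.+1 -> path y4 t k = path y3 t k.
  by move=> hk; rewrite W_path_out; lia.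
have y4_mid k : 2 * n - b.+1 <= k <= 2 * n - a -> path y4 t k =
    Z.min (path y3 t (2 * n - b.+1) + Z.of_nat (k - (2 * n - b.+1)))
      (path y3 t (2 * n - a)).
  by move=> hk; rewrite W_pathA_mirror; lia.
have y3_ma : path y3 t (2 * n - a) = path x t (2 * n - a).
  by rewrite W_path_out ?y2_ma; lia.
(* The last J does not touch the cuts between b + 1 and its mirror, so the final formula must hold
   here already. C and F of [min_JKJ] are the counts at c and 2n - c. *)
have y3_eq k : b.+1 <= k <= 2 * n - b.+1 -> path y3 t k =
    Z.min (path x t a + Z.of_nat (k - a)) (path x t (2 * n - a)).
  move=> hk; have -> : Z.of_nat (k - a) = (Z.of_nat (c - a) + Z.of_nat (k - c))%Z.
    by clear -hk hac; lia.
  rewrite y3_in ?y2_mc ?y2_in ?y1_in; try (clear -hk hac hbd dn; lia).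
  have s1 := @path_step n x t a c.
  have s2 := @path_step n x t (2 * n - c) (2 * n - a).
  by apply: min_JKJ; clear -s1 s2 hac hbd huo hk; lia.
have y4_eq k : a <= k <= 2 * n - a -> path y4 t k =
    Z.min (path x t a + Z.of_nat (k - a)) (path x t (2 * n - a)).
  move=> hk; have [h|h] := leqP k b.+1.
    by rewrite y4_in ?y3_eq; clear -hac hbd hk h; lia.
  have [h'|h'] := leqP k (2 * n - b.+1).
    by rewrite y4_out ?y3_eq //; clear -hac hbd hk h h'; lia.
  by rewrite y4_mid ?y3_ma ?y3_eq; clear -hac hbd hk h h'; lia.
by move=> k hk; rewrite !y4_eq; clear -hk hac hbd; lia.
Qed.

End Pair.
End Sufficient.

(** * Connected vertex sets of B_n *)

Section Connected.
Variable n : nat.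
Implicit Types (J : {set 'I_n}).

Lemma coxB_adj (i j : 'I_n) :
  cox_adj (coxB n) i j = (i.+1 == j) || (j.+1 == i).
Proof.
rewrite /cox_adj /= /coxB_m; have [e|ne] := eqVneq i j.
  by rewrite /= e orbb; apply/esym/negbTE; lia.
by case: ifP => _ //; case: ifP.
Qed.

Lemma connected_subsetP J : reflect
  (forall i j k : 'I_n, i \in J -> j \in J -> i < k < j -> k \in J)
  (connected_subset (coxB n) J).
Proof.
apply: (iffP forall_inP) => [h i j k iJ jJ|h i iJ].
  have /forall_inP/(_ j jJ)/connectP[p pp ->] := h i iJ.
  elim: p i {iJ} pp => [|x p IH] i /=; first by lia.
  move=> /andP[/and3P[_ xJ]]; rewrite coxB_adj => adj /IH{}IH hk.
  have [e|ne] := eqVneq (x : nat) k; first by rewrite -(val_inj e).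
  by apply: IH; case/andP: hk => lik ->; move: adj ne lik; rewrite andbT; case/orP => /eqP a /eqP b; lia.
apply/forall_inP => j jJ; set e := fun x y : 'I_n => _.
have symE : connect_sym e.
  by apply: sym_connect_sym => x y; rewrite /e !coxB_adj andbCA orbC.
have up (a b : 'I_n) d : b = a + d :> nat -> a \in J -> b \in J -> connect e a b.
  elim: d b => [|d IH] b hb aJ bJ.
    have -> : b = a by apply: val_inj; rewrite /= hb addn0.
    exact: connect0.
  have lb : a + d < n by have := ltn_ord b; lia.
  have cJ : Ordinal lb \in J.
    have [d0|dpos] := posnP d; last by apply: h aJ bJ _ => /=; lia.
    by have -> : Ordinal lb = a by apply: val_inj; rewrite /= d0 addn0.
  apply: connect_trans (IH _ _ aJ cJ) _ => //; apply: connect1.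
  by rewrite /e cJ bJ coxB_adj /=; lia.
have [lij|lji] := leqP i j; first by apply: (up _ _ (j - i)) => //; lia.
by rewrite symE; apply: (up _ _ (i - j)) => //; lia.
Qed.

End Connected.

(** * Homomorphisms determined by generators *)

Section Hom.
Variables (I' I : finType) (M' : coxeterMatrix I') (M : coxeterMatrix I).

Definition gprod (f : I' -> hecke M) (u : seq I') : hecke M :=
  foldr (fun k z => f k * z) 1 u.

Lemma gprod_cat f u v : gprod f (u ++ v) = gprod f u * gprod f v.
Proof. by elim: u => [|k u IH] /=; rewrite ?mul1g // IH mulgA. Qed.

Lemma hecke_hom_exists (f : I' -> hecke M) :
  (forall i, f i * f i = f i) ->
  (forall i j, i != j -> gprod f (alternating i j (M' i j)) =
    gprod f (alternating j i (M' i j))) ->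
  exists phi : heckeHom M' M, forall i, phi (hecke_gen M' i) = f i.
Proof.
move=> fI fB; pose F (z : hecke M') := gprod f (repr z).
have cong u v : pres_cong (hecke_rel M') u v -> gprod f u = gprod f v.
  elim=> // {u v} [u v w _ -> _ //|u a b v h].
  rewrite !gprod_cat; congr (_ * (_ * _)); case: h => [i|i j hij]; last exact: fB.
  by rewrite /= !mulg1.
have Fw u : F (hecke_word M' u) = gprod f u.
  by apply: cong; apply/pres_wordP; exact: pres_reprK.
have FM : {morph F : x y / x * y}.
  move=> x y; rewrite -(pres_reprK x) -(pres_reprK y) -pres_word_cat.
  by rewrite ![F _]Fw gprod_cat.
have F1 : F 1 = 1 by exact: (Fw [::]).
pose phi : heckeHom M' M := HB.pack F (isMultiplicative.Build _ _ F FM)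
  (Multiplicative_isUMagmaMorphism.Build _ _ F F1).
by exists phi => i; rewrite [LHS](Fw [:: i]) /= mulg1.
Qed.

Lemma hom_word (phi : heckeHom M' M) u :
  phi (hecke_word M' u) = gprod (fun k => phi (hecke_gen M' k)) u.
Proof.
elim: u => [|i u IH]; first exact: gmulf1.
by rewrite -[hecke_word _ _]/(pres_word _ ([:: i] ++ u)) pres_word_cat gmulfM IH.
Qed.

End Hom.

(** Among nonempty proper alternating words with equal first and equal last letters, only the
    lengths 1 and 3 can differ. *)
Lemma parity_gap k l N : odd k = odd l -> k.+1 < l.+1 -> l.+1 != N ->
  l.+1 <= N -> N <= 4 -> k = 0%N /\ l = 2.
Proof. by case: k l => [|[|k]] [|[|[|l]]] //=; lia. Qed.

(** * Injectivity on rank two submonoids *)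

Section Dihedral.
Variables (r m : nat) (i j : 'I_r).
Hypothesis hij : i != j.
Notation M := (coxB r).
Notation A a b k := (hecke_word M (alternating a b k)).

Definition flipped (a b : 'I_r) := a = i /\ b = j \/ a = j /\ b = i.

Lemma flippedC a b : flipped a b -> flipped b a.
Proof. by move=> [] [-> ->]; [right|left]. Qed.

Lemma alternating_sub a b k : flipped a b ->
  {subset alternating a b k <= [set i; j]%SET}.
Proof.
move=> h c /mapP[l _ ->]; rewrite !inE.
by case: h => [] [-> ->]; case: (odd l); rewrite eqxx ?orbT.
Qed.

Lemma alternating_wordS a b k : A a b k.+1 = hecke_gen M a * A b a k.
Proof. by rewrite alternatingS hecke_word_cons. Qed.

Lemma alternating_word_idem a b k : hecke_gen M a * A a b k.+1 = A a b k.+1.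
Proof. by rewrite alternating_wordS mulgA hecke_gen2. Qed.

Lemma alternating_word_braid a b : flipped a b -> A a b (M i j) = A b a (M i j).
Proof.
have e : A i j (M i j) = A j i (M i j).
  apply/pres_wordP; have := pres_step [::] [::] (HeckeBraid M hij).
  by rewrite !cats0.
by move=> [] [-> ->].
Qed.

Lemma coxB_range : 2 <= M i j <= 4.
Proof. by rewrite /= /coxB_m (negbTE hij); case: ifP => // _; case: ifP. Qed.

Notation full := (A i j (M i j)).

Lemma alternating_word_absorbs : absorbs [set i; j]%SET full.
Proof.
have hf : flipped i j by left.
split; first by exists (alternating i j (M i j)) => //; exact: alternating_sub.
have [k ek] : exists k, M i j = k.+1.
  by exists (M i j).-1; rewrite prednK //; have := coxB_range; lia.
move=> c; rewrite !inE => /orP[] /eqP ->; first by rewrite ek alternating_word_idem.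
by rewrite (alternating_word_braid hf) ek alternating_word_idem.
Qed.

Lemma alternating_word_rcons a b k : A a b k.+1 = A a b k * hecke_gen M (if odd k then b else a).
Proof. by rewrite /alternating mkseqS -cats1 [LHS]pres_word_cat. Qed.

Lemma dihedral_nf u : {subset u <= [set i; j]%SET} -> exists a b k,
  [/\ flipped a b, k <= M i j & hecke_word M u = A a b k].
Proof.
elim: u => [|c u IH] su; first by exists i, j, 0%N; split=> //; left.
have [|a [b [k [hf hk e]]]] := IH; first by move=> l lu; apply: su; rewrite inE lu orbT.
rewrite hecke_word_cons e.
have [e'|e'] : c = a \/ c = b.
  have := su c (mem_head c u); rewrite !inE => /orP[] /eqP ->;
  by case: hf => [] [-> ->]; auto.
  case: k hk {e} => [|k] hk.
    by exists a, b, 1%N; rewrite e' alternating_wordS; split=> //; have := coxB_range; lia.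
  by exists a, b, k.+1; rewrite e' alternating_word_idem.
have [hk'|hk'] := ltnP k (M i j).
  by exists b, a, k.+1; rewrite e' -alternating_wordS; split=> //; exact: flippedC.
have {hk hk'} ek : k = M i j by lia.
exists b, a, k; split; [exact: flippedC|by rewrite ek|].
rewrite ek (alternating_word_braid hf) e'; have [l ->] : exists l, M i j = l.+1.
  by exists (M i j).-1; rewrite prednK //; have := coxB_range; lia.
exact: alternating_word_idem.
Qed.

Variable phi : heckeHom (coxB r) (coxB m).
Notation P c := (phi (hecke_gen M c)).
Hypothesis incomparable : forall a b, flipped a b ->
  ~~ (hecke_supp (P a) \subset hecke_supp (P b)).
Hypothesis not_full : forall a b, flipped a b -> phi (A a b (M i j).-1) <> phi full.

(** The missing letters extend the word to length m_ij - 1, while on the right the full word absorbs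
    them. *)
Lemma phi_not_full a b k : flipped a b -> k < M i j -> phi (A a b k) <> phi full.
Proof.
move=> hf hk e; apply: (not_full hf); set N := (M i j).-1.
have <- : alternating a b k ++ drop k (alternating a b N) = alternating a b N.
  rewrite -[RHS](cat_take_drop k); congr (_ ++ _).
  by rewrite /alternating -map_take take_iota; congr map; congr iota; rewrite /N; lia.
rewrite [hecke_word _ _]pres_word_cat gmulfM e -gmulfM.
congr (phi _); apply: (absorbs_wordr alternating_word_absorbs) => c /mem_drop.
exact: alternating_sub.
Qed.

(* Two words with distinct first letters have a common image only if that image
   absorbs both generators on the left, that is, if it is the image of full. *)
Lemma phi_left a b k l : flipped a b -> k.+1 < M i j ->
  phi (A a b k.+1) <> phi (A b a l.+1).
Proof.
move=> hf hk e; apply: (phi_not_full hf hk).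
have gen c : c \in [set i; j]%SET -> P c * phi (A a b k.+1) = phi (A a b k.+1).
  move=> hc; have [->|->] : c = a \/ c = b.
    by move: hc; rewrite !inE => /orP[] /eqP ->; case: hf => [] [-> ->]; auto.
    by rewrite -gmulfM alternating_word_idem.
  by rewrite e -gmulfM alternating_word_idem.
have word u : {subset u <= [set i; j]%SET} ->
    phi (hecke_word M u) * phi (A a b k.+1) = phi (A a b k.+1).
  elim: u => [|c u IH] su; first by rewrite [phi _]gmulf1 mul1g.
  rewrite hecke_word_cons gmulfM -mulgA IH ?gen //; first by rewrite su ?mem_head.
  by move=> d du; apply: su; rewrite inE du orbT.
have hf' : flipped i j by left.
rewrite -(word _ (@alternating_sub i j (M i j) hf')) -gmulfM.
congr (phi _); apply: (absorbs_wordr alternating_word_absorbs); exact: alternating_sub.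
Qed.

(** Mirror image of [phi_left]: the parities make the last letters differ, so a common image absorbs
    both generators on the right. *)
Lemma phi_right a b k l : flipped a b -> k.+1 < M i j -> odd k != odd l ->
  phi (A a b k.+1) <> phi (A a b l.+1).
Proof.
move=> hf hk hkl e; apply: (phi_not_full hf hk).
have gen c : c \in [set i; j]%SET -> phi (A a b k.+1) * P c = phi (A a b k.+1).
  move=> hc; have [->|->] :
      c = (if odd k then b else a) \/ c = (if odd l then b else a).
    move: hc hkl; rewrite !inE; case: (odd k); case: (odd l) => // + _;
    by move=> /orP[] /eqP ->; case: hf => [] [-> ->]; auto.
    by rewrite -gmulfM alternating_word_rcons -mulgA hecke_gen2.
  by rewrite e -gmulfM alternating_word_rcons -mulgA hecke_gen2.
have word u : {subset u <= [set i; j]%SET} ->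
    phi (A a b k.+1) * phi (hecke_word M u) = phi (A a b k.+1).
  elim: u => [|c u IH] su; first by rewrite [phi (hecke_word _ [::])]gmulf1 mulg1.
  rewrite (hecke_word_cons c u) gmulfM mulgA gen ?IH //; last by rewrite su ?mem_head.
  by move=> d du; apply: su; rewrite inE du orbT.
have hf' : flipped i j by left.
rewrite -(word _ (@alternating_sub i j (M i j) hf')) -gmulfM.
congr (phi _); apply: (absorbs_word alternating_word_absorbs); exact: alternating_sub.
Qed.

Lemma dihedral_injective : {in hecke_parabolic M [set i; j]%SET &, injective phi}.
Proof.
have key a b k a' b' l : flipped a b -> flipped a' b' -> k <= l <= M i j ->
    phi (A a b k) = phi (A a' b' l) -> A a b k = A a' b' l.
  move=> hf hf' /andP[]; rewrite leq_eqVlt => /orP[/eqP ekl|lkl] lm e; last first.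
    have lk : k < M i j by lia.
    have [el|nel] := eqVneq l (M i j).
      case: (phi_not_full hf lk); rewrite e el.
      by case: hf' => [] [-> ->] //; rewrite -alternating_word_braid //; left.
    case: k lkl lk e => [|k] lkl lk e.
      case: l lkl lm nel e => // l _ _ _ e.
      have e1 : P a' = 1.
        have := congr1 (fun z => P a' * z) e; rewrite -[RHS]gmulfM alternating_word_idem -e.
        by rewrite [phi (A a b 0)]gmulf1 mulg1.
      have := incomparable hf'; rewrite e1.
      have -> : hecke_supp (1 : hecke (coxB m)) = finset.set0.
        by rewrite [LHS](hecke_supp_word [::]); apply/setP => ?; rewrite !inE.
      by rewrite finset.sub0set.
    case: l lkl lm nel e => // l lkl lm nel e.
    have [ea|nea] := eqVneq a a'; last first.
      have eb : a' = b /\ b' = a.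
        by move: nea; case: hf => [] [-> ->]; case: hf' => [] [-> ->]; rewrite ?eqxx.
      by case: eb e => -> -> /(phi_left hf lk).
    have eb : b' = b.
      move: ea hij; case: hf => [] [-> ->]; case: hf' => [] [-> ->] // ->;
      by rewrite eqxx.
    rewrite -ea eb in e; have [okl|] := eqVneq (odd k) (odd l); last first.
      by move=> okl; case: (phi_right hf lk okl e).
    have /andP[_ m4] := coxB_range.
    have [ek el] := parity_gap okl lkl nel lm m4; subst k l.
    (* The words a and aba remain: if their images agreed, the support of the image of b would lie
       in that of a. *)
    have := incomparable (flippedC hf).
    have <- : phi (A a b 1) = P a by rewrite alternating_wordS; congr (phi _); exact: mulg1.
    rewrite e alternating_wordS alternating_wordS !gmulfM !hecke_suppM.
    by rewrite finset.setUCA finset.subsetUl.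
  subst l; have [ea|nea] := eqVneq a a'.
    have -> : b' = b.
      move: ea hij; case: hf => [] [-> ->]; case: hf' => [] [-> ->] // ->;
      by rewrite eqxx.
    by rewrite ea.
  have [ea' eb'] : a' = b /\ b' = a.
    by move: nea; case: hf => [] [-> ->]; case: hf' => [] [-> ->]; rewrite ?eqxx.
  subst a' b'; have [->|ne] := eqVneq k (M i j); first exact: alternating_word_braid.
  case: k lm e ne => // k lm e ne; case: (phi_left (k := k) (l := k) hf _ e); lia.
move=> z z'; rewrite !in_setE => /hecke_parabolicP[u su <-] /hecke_parabolicP[v sv <-].
have [a [b [k [hf hk ->]]]] := dihedral_nf su.
have [a' [b' [l [hf' hl ->]]]] := dihedral_nf sv.
have [kl|lk] := leqP k l; first by apply: key => //; rewrite kl.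
by move=> /esym e; apply/esym; apply: key => //; rewrite (ltnW lk).
Qed.

End Dihedral.

(** * Chains of intervals *)

Section Chain.
Variables (r m : nat) (lo hi : nat -> nat).

(* The i-th interval, with i counted from 0, consists of the vertices lo i, ..., hi i - 1. *)
Record chain : Prop := Chain {
  chain_first : lo 0 < hi 0;
  chain_last : hi r.-1 = m;
  chain_step : forall i, i.+1 < r ->
    [/\ lo i < lo i.+1 <= hi i, hi i < hi i.+1 &
        lo i.+1 - lo i <= (hi i).+1 - lo i.+1];
  chain_step3 : forall i, i.+2 < r -> hi i.+1 - hi i <= (hi i).+1 - lo i.+1;
  chain_far : forall i j, i.+1 < j < r -> hi i < lo j }.

Hypothesis ch : chain.

Lemma chain_mono i j : i < j < r -> lo i < lo j /\ hi i < hi j.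
Proof.
elim: j => [|j IH] h; first by lia.
have [h1 h2 _] := chain_step ch (i := j) ltac:(lia).
have [e|ne] := eqVneq i j; first by subst i; split; lia.
by have [] := IH ltac:(lia); split; lia.
Qed.

Lemma chain_bounds i : i < r -> lo i < hi i <= m.
Proof.
move=> h; have top : hi i <= m.
  rewrite -(chain_last ch); have [e|ne] := eqVneq i r.-1; first by rewrite e.
  by have [] := @chain_mono i r.-1 ltac:(lia); lia.
rewrite top andbT; case: i h {top} => [|i] h; first exact: chain_first.
by have [h1 h2 _] := chain_step ch h; lia.
Qed.

Lemma chain_lt_top i : i.+1 < r -> hi i < m.
Proof.
by move=> h; have [_ h2 _] := chain_step ch h; have := chain_bounds h; lia.
Qed.

Definition chain_gen (i : 'I_r) : hecke (coxB m) := W m (lo i) (hi i).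

Lemma chain_braid (i j : 'I_r) : i != j ->
  gprod chain_gen (alternating i j (coxB r i j)) =
  gprod chain_gen (alternating j i (coxB r i j)).
Proof.
wlog lij : i j / i < j => [wl hij|_].
  have [lij|lji|e] := ltngtP i j; first exact: wl.
    by have -> : coxB r i j = coxB r j i := coxB_mC i j; rewrite wl // eq_sym.
  by move: hij; rewrite (val_inj e) eqxx.
have [[-> h]|[-> [h1 h2]]|[-> [h1 h2]]] := coxB_cases lij;
  rewrite /alternating /mkseq /= !mulg1 /chain_gen ?h1 ?mulgA.
- by apply: W_far; apply: chain_far.
- have ir : i.+1 < r by lia.
  have [s1 s2 s3] := chain_step ch ir; have s4 := chain_step3 ch h2.
  have s5 := chain_lt_top h2.
  by rewrite (@W_braid3_JKJ m) ?(@W_braid3_KJK m) //; lia.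
- have ir : i.+1 < r by lia.
  have [s1 s2 s3] := chain_step ch ir.
  have e : hi i.+1 = m by rewrite -(chain_last ch); congr hi; lia.
  by rewrite (@W_braid4_JKJK m) ?(@W_braid4_KJKJ m) //; lia.
Qed.

Lemma chain_hom_exists :
  exists phi : heckeHom (coxB r) (coxB m),
    forall i, phi (hecke_gen (coxB r) i) = chain_gen i.
Proof.
apply: hecke_hom_exists => [i|]; first exact: hecke_longest_mul2.
exact: chain_braid.
Qed.

Variable phi : heckeHom (coxB r) (coxB m).
Hypothesis phiE : forall i, phi (hecke_gen (coxB r) i) = chain_gen i.

Lemma supp_chain_gen (i : 'I_r) (k : 'I_m) :
  (k \in hecke_supp (chain_gen i)) = (lo i <= k < hi i).
Proof. by rewrite hecke_supp_longest mem_interval. Qed.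

Lemma chain_incomparable (i j : 'I_r) : i < j ->
  ~~ (hecke_supp (chain_gen i) \subset hecke_supp (chain_gen j)) /\
  ~~ (hecke_supp (chain_gen j) \subset hecke_supp (chain_gen i)).
Proof.
move=> lij; have [|l1 l2] := @chain_mono i j; first by rewrite lij ltn_ord.
have bi := chain_bounds (ltn_ord i); have bj := chain_bounds (ltn_ord j).
split; apply/negP => /fintype.subsetP s.
  have lk : lo i < m by lia.
  by have := s (Ordinal lk); rewrite !supp_chain_gen /=; lia.
have lk : (hi j).-1 < m by lia.
by have := s (Ordinal lk); rewrite !supp_chain_gen /=; lia.
Qed.

Lemma chain_locally_injective : locally_injective phi.
Proof.
move=> i j.
wlog lij : i j / i < j => [wl hij|hij].
  have [lij|lji|e] := ltngtP i j; first exact: wl.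
    by rewrite finset.setUC; apply: wl; rewrite // eq_sym.
  by move: hij; rewrite (val_inj e) eqxx.
have [inc1 inc2] := chain_incomparable lij.
have inc a b : flipped i j a b ->
    ~~ (hecke_supp (phi (hecke_gen (coxB r) a)) \subset
        hecke_supp (phi (hecke_gen (coxB r) b))).
  by rewrite !phiE => -[] [-> ->].
apply: (dihedral_injective hij inc) => a b hab.
have hall : hi j <= m by have := chain_bounds (ltn_ord j); lia.
have [[-> h]|[-> [h1 h2]]|[-> [h1 h2]]] := coxB_cases lij;
  rewrite !hom_word /alternating /mkseq /= !mulg1 ?mulgA !phiE => e.
- have := inc b a (flippedC hab); rewrite !phiE e hecke_suppM => /negP; apply.
  by case: hab => [] [_ ->]; [apply: finset.subsetUr|apply: finset.subsetUl].
(* If the product of the two were full, reversal would give the same for the other order, and they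
   would commute. *)
- have ir : i.+1 < r by lia.
  have [s1 s2 s3] := chain_step ch ir; have s4 := chain_step3 ch h2.
  have s5 := chain_lt_top h2; rewrite /chain_gen ?h1 in e.
  rewrite (@W_braid3_JKJ m) in e; try lia.
  apply: (@W_overlap_comm m (lo i) (hi i) (lo i.+1) (hi i.+1)); try lia.
  case: hab e => [] [-> ->]; rewrite h1 => e.
    exact: etrans e (esym (hecke_longest_mulC e)).
  exact: etrans (hecke_longest_mulC e) (esym e).
(* If three factors already gave the longest element of the union, their product would absorb both
   generators, which [W_top_JKJ] and [W_top_KJK] exclude. *)
- have ir : i.+1 < r by lia.
  have [s1 s2 s3] := chain_step ch ir; rewrite /chain_gen ?h1 in e.
  have et : hi i.+1 = m by rewrite -(chain_last ch); congr hi; lia.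
  have ab s t : lo i <= s -> t <= m -> W m s t * W m (lo i) m = W m (lo i) m.
    move=> hs ht; have [u su <-] := @word_in_W m s t (lo i) m hs ht.
    exact: (absorbs_word (hecke_longestP _)).
  rewrite (@W_braid4_JKJK m) in e; try lia.
  case: hab e => [] [-> ->]; rewrite h1 => e.
    apply: (@W_top_JKJ m (lo i) (hi i) (lo i.+1) (hi i.+1)); try lia.
    by rewrite e ab //; lia.
  apply: (@W_top_KJK m (lo i) (hi i) (lo i.+1) (hi i.+1)); try lia.
  by rewrite e ab //; lia.
Qed.

Lemma chain_connected : connected_hom phi.
Proof.
move=> S /connected_subsetP cS; apply/connected_subsetP => x y k.
move=> /finset.bigcupP[i iS]; rewrite phiE supp_chain_gen => hx.
move=> /finset.bigcupP[j jS]; rewrite phiE supp_chain_gen => hy hk.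
suff [l lS hl] : exists2 l : 'I_r, l \in S & lo l <= k < hi l.
  by apply/finset.bigcupP; exists l; rewrite // phiE supp_chain_gen.
have [lij|lji] := ltnP i j; last first.
  exists j => //; have [e|ne] := eqVneq (i : nat) j.
    by rewrite -e in hy *; lia.
  by have [|] := @chain_mono j i; [have := ltn_ord i|]; lia.
have mem (t : 'I_r) : i <= t <= j -> t \in S.
  move=> ht; have [e|ne] := eqVneq (t : nat) i; first by rewrite (val_inj e).
  have [e'|ne'] := eqVneq (t : nat) j; first by rewrite (val_inj e').
  by apply: cS iS jS _; lia.
(* The last interval from i to j that starts at or before k contains k, since consecutive intervals
   leave no gap. *)
have [t [ht kt]] : exists t : nat, i <= t <= j /\ lo t <= k < hi t.
  have {hy}: k < hi j by lia.
  have {lij mem}: i <= j by lia.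
  have := ltn_ord j; elim: (j : nat) => [|d IH] dr id hd.
    have e : (i : nat) = 0%N by lia.
    by exists 0%N; rewrite e in hx; lia.
  have [h|h] := leqP (lo d.+1) k; first by exists d.+1; lia.
  have [e|ne] := eqVneq (i : nat) d.+1; first by rewrite -e in h; lia.
  have [s1 s2 _] := chain_step ch dr.
  by have [|||t [ht kt]] := IH; [lia|lia|lia|exists t; lia].
have lt : t < r by have := ltn_ord j; lia.
by exists (Ordinal lt) => //; exact: mem.
Qed.

End Chain.

(** * The intervals prescribed by mu *)

Section Theta.
Variables (r m : nat).
Hypothesis hr : 3 <= r.

(** For p = mu_r and l = mu_2 this is the endpoint a_i of mu'. Counted from 0, J_(i+1) starts at a_i
    and stops before a_(i+2) - 1, whence [hi_of]. *)
Definition lo_of (p l i : nat) : nat := if i == 0%N then 0%N else (p + i.-1 * l)%N.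

Definition hi_of (p l i : nat) : nat :=
  if i.+1 == r then m else (p + i.+1 * l).-1.

Lemma chain_of p l k : 0 < p <= l -> l <= k -> m = (k + (r - 2) * l + p)%N ->
  chain r m (lo_of p l) (hi_of p l).
Proof.
move=> hp hl hm; have er : r = (r - 2).+2 by lia.
have hlast : (p + (r - 2) * l + k = m)%N by lia.
split.
- by rewrite /lo_of /hi_of /=; case: eqP; lia.
- by rewrite /hi_of prednK ?eqxx //; lia.
- move=> i ir; rewrite /lo_of /hi_of /=.
  have -> : (i.+1 == r) = false by lia.
  have [h|h] := eqVneq i.+2 r; last first.
    by case: i ir {h} => [|i] ir /=; split; rewrite ?mulSn; lia.
  have ei : r - 2 = i by lia.
  rewrite ei in hlast; have [i' e] : exists i', i = i'.+1 by exists i.-1; lia.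
  by move: h ir hlast; rewrite {ei}e /= !mulSn => h ir hlast; split; lia.
- move=> i ir; rewrite /lo_of /hi_of /=.
  have -> : (i.+1 == r) = false by lia.
  have -> : (i.+2 == r) = false by lia.
  by case: i ir => [|i] ir /=; rewrite ?mulSn; lia.
- move=> i j h; rewrite /lo_of /hi_of.
  have -> : (i.+1 == r) = false by lia.
  have -> : (j == 0%N) = false by lia.
  have : (i.+1 * l <= j.-1 * l)%N by rewrite leq_mul2r; lia.
  by lia.
Qed.

Lemma sum_parts (f : nat -> nat) :
  (forall j, 2 <= j <= r - 1 -> f j = f 2) ->
  (\sum_(1 <= j < r.+1) f j = f 1%N + (r - 2) * f 2 + f r)%N.
Proof.
move=> h; rewrite big_nat_recr /=; last by lia.
rewrite big_ltn; last by lia.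
congr (_ + _ + _)%N; rewrite (eq_big_nat _ _ (F2 := fun=> f 2)).
  by rewrite sum_nat_const_nat.
by move=> j hj; apply: h; lia.
Qed.

Variable mu : seq nat.
Hypothesis hmu : posB r m mu.
Notation p := (part mu r).
Notation l := (part mu 2).
Notation k := (part mu 1).

Lemma posB_sum : m = (k + (r - 2) * l + p)%N.
Proof. by have [_ _ h _ <-] := hmu; rewrite sum_parts. Qed.

Lemma posB_bounds : 0 < p <= l /\ l <= k.
Proof.
have [_ h0 h /andP[h1 h2] _] := hmu; split=> //.
by rewrite h0 ?(leq_trans h1) ?(h (r - 1)); lia.
Qed.

Lemma size_mu_prime : size (mu_prime mu) = r.
Proof. by have [s _ _ _ _] := hmu; rewrite /mu_prime /= size_behead s; lia. Qed.

Lemma part_mu_prime j : 0 < j -> part (mu_prime mu) j = if j == 1%N then l else part mu j.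
Proof. by case: j => [|[|j]] // _; rewrite /part /mu_prime /= nth_behead. Qed.

Lemma part_mu_prime_mid j : 1 <= j <= r - 1 -> part (mu_prime mu) j = l.
Proof.
move=> hj; rewrite part_mu_prime; last by lia.
case: eqP => // ne; have [_ _ h _ _] := hmu.
by apply: h; lia.
Qed.

Lemma part_mu_prime_last : part (mu_prime mu) r = p.
Proof. by rewrite part_mu_prime; [have -> : (r == 1%N) = false by lia|lia]. Qed.

Lemma posA_mu_prime : posA r (m - k + l) (mu_prime mu).
Proof.
have [[p0 pl] lk] := (andP posB_bounds.1, posB_bounds.2); have em := posB_sum.
split.
- exact: size_mu_prime.
- move=> j hj; have [e|ne] := eqVneq j r; first by rewrite e part_mu_prime_last.
  by rewrite part_mu_prime_mid; lia.
- by move=> j hj; rewrite !part_mu_prime_mid //; lia.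
- by rewrite part_mu_prime_last !part_mu_prime_mid ?pl ?leqnn //; lia.
- rewrite sum_parts => [|j hj]; last by rewrite !part_mu_prime_mid //; lia.
  rewrite part_mu_prime_last !part_mu_prime_mid; try lia.
  by rewrite em; move: ((r - 2) * l)%N => q; lia.
Qed.

Lemma endpoint_mu_prime i : i <= r -> endpoint (mu_prime mu) i = lo_of p l i.
Proof.
move=> ir; rewrite /endpoint /lo_of; case: eqP => // ne.
rewrite size_mu_prime part_mu_prime_last; congr (_ + _)%N.
rewrite (eq_big_nat _ _ (F2 := fun=> l)); last first.
  by move=> j hj; apply: part_mu_prime_mid; lia.
by rewrite sum_nat_const_nat; congr (_ * _)%N; lia.
Qed.

Lemma theta_genE (i : 'I_r) :
  theta_gen m mu i = chain_gen m (lo_of p l) (hi_of p l) i.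
Proof.
rewrite /theta_gen /chain_gen /W /hi_of; case: ltnP => h.
  rewrite /blockJ endpoint_mu_prime; last by lia.
  rewrite endpoint_mu_prime //; have -> : (i.+1 == r) = false by lia.
  by [].
have ei : i.+1 = r by have := ltn_ord i; lia.
rewrite ei eqxx; congr (hecke_longest _ (interval m _.+1 m)).
rewrite /lo_of; have -> : ((i : nat) == 0%N) = false by lia.
have -> : (i : nat).-1 = r - 2 by lia.
by rewrite {1}posB_sum; move: ((r - 2) * l)%N => q; lia.
Qed.

Lemma chain_theta : chain r m (lo_of p l) (hi_of p l).
Proof.
have [h1 h2] := posB_bounds; exact: chain_of h1 h2 posB_sum.
Qed.

End Theta.

(** * The converse *)

Section Classify.
Variables (r m : nat) (L H : nat -> nat).
Hypothesis hr : 3 <= r.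
Hypothesis bnd : forall i, i < r -> L i < H i <= m.
Hypothesis nc : forall i j, i < r -> j < r -> i != j -> ~~ ((L j <= L i) && (H i <= H j)).
Hypothesis far : forall i j, i.+1 < j < r -> (H i < L j) || (H j < L i).
Hypothesis b3 : forall i, i.+2 < r ->
  [/\ L i < L i.+1, H i < H i.+1 < m, L i.+1 - L i <= (H i).+1 - L i.+1 &
      H i.+1 - H i <= (H i).+1 - L i.+1] \/
  [/\ L i.+1 < L i & H i.+1 < H i < m].
Hypothesis touch : forall i, i.+1 < r -> (L i.+1 <= H i) && (L i <= H i.+1).
Hypothesis b4 : forall i, i.+2 = r -> L i < L i.+1 -> H i < H i.+1 -> H i.+1 = m ->
  L i.+1 - L i <= (H i).+1 - L i.+1.
Hypothesis full : forall k, k < m -> exists2 i, i < r & L i <= k < H i.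

(** An interval reaching the last vertex satisfies no braid relation of length three, and every
    generator of B_r but the last takes part in one because r >= 3. *)
Lemma classify_H_lt i : i.+1 < r -> H i < m.
Proof.
move=> ir; have [h|h] := ltnP i.+2 r; first by case: (b3 h) => -[]; lia.
case: i ir h => [|i] ir h; first by lia.
have h' : i.+2 < r by lia.
by case: (b3 h') => -[]; lia.
Qed.

Lemma classify_H_last : H r.-1 = m.
Proof.
have m0 : 0 < m by have := bnd (i := 0%N); lia.
have km : m.-1 < m by lia.
have [i ir hi] := full km; have [h|h] := ltnP i.+1 r.
  by have := classify_H_lt h; lia.
have -> : r.-1 = i by lia.
by have := bnd ir; lia.
Qed.

(** The last pair is oriented because only its second interval reaches m. A change of direction at i
    + 1 would bring the intervals i and i + 2 into contact, contrary to [far]. *)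
Lemma classify_order i : i.+1 < r -> L i < L i.+1 /\ H i < H i.+1.
Proof.
move=> ir; have [d ed] : exists d, i + d.+2 = r by exists (r - i.+2); lia.
elim: d i ir ed => [|d IH] i ir ed.
  have hi : H i.+1 = m by rewrite -classify_H_last; congr H; lia.
  by have := classify_H_lt ir; have := nc (i := i) (j := i.+1); lia.
have [||l1 h1] := IH i.+1; [lia|lia|].
have h2 : i.+2 < r by lia.
case: (b3 h2) => [[o1 o2 _ _]|[o1 o2]]; first by lia.
by have := far (i := i) (j := i.+2); have := touch h2; have := touch ir; lia.
Qed.

Lemma classify_gap i : i.+2 < r -> H i < L i.+2.
Proof.
move=> ir; have ir' : i.+1 < r by lia.
have := classify_order ir; have := classify_order ir'.
have := far (i := i) (j := i.+2); have := bnd ir; lia.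
Qed.

Lemma classify_first : L 0 = 0%N.
Proof.
have m0 : 0 < m by have := bnd (i := 0%N); lia.
have [i ir hi] := full m0; case: i ir hi => [|i] ir hi; first by lia.
by have := classify_order ir; lia.
Qed.

Lemma classify_mid i : 0 < i -> i.+1 < r ->
  let l := (H i.-1).+1 - L i in
  [/\ L i.+1 = (H i.-1).+1, H i = (H i.-1 + l)%N, L i.+1 = (L i + l)%N & 0 < l].
Proof.
case: i => // i _ ir /=.
have h1 : i.+1 < r by lia.
have g := classify_gap ir; have [o1 o2] := classify_order h1.
have [o3 o4] := classify_order ir; have t := touch h1; have t' := touch ir.
have [[s1 s2 s3 s4]|[s1 _]] := b3 ir; last by lia.
(* For the last pair the bound comes from the relation of length four. *)
have s5 : L i.+2 - L i.+1 <= (H i.+1).+1 - L i.+2.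
  have [h|h] := ltnP i.+3 r; first by have [[]|[]] := b3 h; lia.
  apply: b4 => //; first by lia.
  by rewrite -classify_H_last; congr H; lia.
(* The overlap of i, i + 1 is at most the left margin of the next pair ([g]), this at most the next
   overlap ([s5]), this at most the right margin of i, i + 1 ([g]), and this at most the first
   overlap ([s4]). All four are equal. *)
by split; lia.
Qed.

Lemma classify : exists p l k, [/\ 0 < p <= l, l <= k,
  m = (k + (r - 2) * l + p)%N &
  forall i, i < r -> L i = lo_of p l i /\ H i = hi_of r m p l i].
Proof.
pose p := L 1; pose l := (H 0).+1 - L 1; have L0 := classify_first.
have r1 : 1 < r by lia.
have [o1 o2] := classify_order r1; have t1 := touch r1.
have hpl : 0 < p <= l.
  by have [[]|[]] := b3 (i := 0%N) hr; rewrite /p /l; lia.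
have main i : i.+1 < r -> 
    H i = (p + i.+1 * l).-1 /\ L i.+1 = (p + i * l)%N /\ (H i).+1 - L i.+1 = l.
  elim: i => [|i IH] ir; first by rewrite mul1n mul0n /p /l; lia.
  have [e1 [e2 e3]] := IH (ltnW ir).
  have [] := classify_mid (i := i.+1) isT ir; rewrite /= e3 !mulSn => f1 f2 f3 f4.
  rewrite mulSn in e1; lia.
have er : r = (r - 3).+3 by lia.
have [e1 [e2 e3]] := main (r - 2) ltac:(lia).
have hl := classify_H_lt (i := r - 2) ltac:(lia).
have e4 : (r - 2).+1 = r.-1 by lia.
exists p, l, (m - L r.-1); split=> //.
- by rewrite -e4; lia.
- by rewrite -e4 e2; lia.
move=> i ir; rewrite /lo_of /hi_of; split.
  by case: i ir => // i ir /=; have [_ []] := main i ir.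
case: eqP => [e|ne]; first by rewrite -classify_H_last -e.
by have [] := main i ltac:(lia).
Qed.

End Classify.

Lemma connected_interval n (S : {set 'I_n}) (i0 : 'I_n) : i0 \in S ->
  connected_subset (coxB n) S ->
  exists a b, a < b <= n /\ S = interval n a.+1 b.
Proof.
move=> iS /connected_subsetP cS.
case: (arg_minnP (fun i : 'I_n => i : nat) iS) => a aS amin.
case: (arg_maxnP (fun i : 'I_n => i : nat) iS) => b bS bmax.
exists a, b.+1; have ab := amin b bS; split; first by have := ltn_ord b; lia.
apply/setP => k; rewrite mem_interval; apply/idP/idP => [kS|hk].
  by have := amin k kS; have := bmax k kS; lia.
have [e|ne] := eqVneq (k : nat) a; first by rewrite (val_inj e).
have [e'|ne'] := eqVneq (k : nat) b; first by rewrite (val_inj e').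
by apply: cS aS bS _; lia.
Qed.

(** * From a homomorphism to its intervals *)

Section Converse.
Variables (r m : nat) (phi : heckeHom (coxB r) (coxB m)).
Hypothesis hr : 3 <= r.
Hypothesis phi_inj : locally_injective phi.
Hypothesis phi_conn : connected_hom phi.
Hypothesis phi_full : fully_supported phi.
Notation gen i := (hecke_gen (coxB r) i).
Notation P i := (phi (gen i)).

Lemma phi_inj_words (i j : 'I_r) u v : i != j ->
  {subset u <= [:: i; j]} -> {subset v <= [:: i; j]} ->
  phi (hecke_word (coxB r) u) = phi (hecke_word (coxB r) v) -> u =i v.
Proof.
move=> hij su sv e; apply/hecke_word_mem/(phi_inj hij) => //; rewrite in_setE;
  apply/hecke_parabolicP.
- by exists u => // k /su; rewrite !inE.
- by exists v => // k /sv; rewrite !inE.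
Qed.

Lemma phi_gen_neq1 (i : 'I_r) : P i != 1.
Proof.
apply/eqP => e.
have [j hij] : exists j : 'I_r, i != j.
  have r0 : 0 < r by lia.
  have r1 : 1 < r by lia.
  have [e0|ne0] := eqVneq i (Ordinal r0); last by exists (Ordinal r0).
  by exists (Ordinal r1); rewrite e0.
have := @phi_inj_words i j [:: i] [::] hij.
rewrite [phi (hecke_word _ [::])]gmulf1 => h.
have /(_ i) : [:: i] =i [::] by apply: h => // k; rewrite !inE => ->.
by rewrite !inE eqxx.
Qed.

Lemma phi_gen_idem (i : 'I_r) : P i * P i = P i.
Proof. by rewrite -gmulfM hecke_gen2. Qed.

Lemma hom_supp1 (i : 'I_r) : hom_supp phi [set i]%SET = hecke_supp (P i).
Proof. by rewrite /hom_supp finset.big_set1. Qed.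

Lemma phi_gen_interval (i : 'I_r) : exists a b, a < b <= m /\ P i = W m a b.
Proof.
have cS : connected_subset (coxB m) (hecke_supp (P i)).
  rewrite -hom_supp1; apply: phi_conn; apply/connected_subsetP => j1 j2 j3.
  by rewrite !inE => /eqP -> /eqP ->; lia.
have eP := idempotent_longest (phi_gen_idem i).
have [e0|[k0 kS]] := finset.set_0Vmem (hecke_supp (P i)).
  have /eqP[] := phi_gen_neq1 i; rewrite eP e0.
  have [[u su <-] _] := hecke_longestP (finset.set0 : {set 'I_m}).
  by case: u su => // k u /(_ k (mem_head k u)); rewrite inE.
have [a [b [hab e]]] := connected_interval kS cS.
by exists a, b; rewrite eP e.
Qed.

Lemma phi_intervals : exists L H : nat -> nat,
  forall i : 'I_r, L i < H i <= m /\ P i = W m (L i) (H i).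
Proof.
have /choice[f hf] : forall k : nat, exists ab : nat * nat,
    forall i : 'I_r, i = k :> nat -> ab.1 < ab.2 <= m /\ P i = W m ab.1 ab.2.
  move=> k; have [kr|rk] := ltnP k r.
    have [a [b hab]] := phi_gen_interval (Ordinal kr); exists (a, b) => i e.
    by have -> : i = Ordinal kr by apply: val_inj.
  by exists (0%N, 0%N) => i e; have := ltn_ord i; lia.
by exists (fun k => (f k).1), (fun k => (f k).2) => i; exact: hf.
Qed.

Lemma phi_theta_gen : exists p l k, [/\ 0 < p <= l, l <= k,
  m = (k + (r - 2) * l + p)%N &
  forall i : 'I_r, P i = W m (lo_of p l i) (hi_of r m p l i)].
Proof.
have [L [H hLH]] := phi_intervals.
have bnd i : i < r -> L i < H i <= m by move=> ir; have [] := hLH (Ordinal ir).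
have PE i (ir : i < r) : P (Ordinal ir) = W m (L i) (H i).
  by have [] := hLH (Ordinal ir).
(* Nested intervals would give P i P j = P j, identifying two words with different letters. *)
have nc i j : i < r -> j < r -> i != j -> ~~ ((L j <= L i) && (H i <= H j)).
  move=> ir jr nij; apply/negP => /andP[h1 h2].
  have hij : Ordinal ir != Ordinal jr by [].
  have /(_ (Ordinal ir)) : [:: Ordinal ir; Ordinal jr] =i [:: Ordinal jr].
    apply: (phi_inj_words hij) => [//|k|]; first by rewrite !inE => ->; rewrite orbT.
    rewrite -[RHS]/(P (Ordinal jr)) (hecke_word_cons (Ordinal ir) [:: Ordinal jr]).
    rewrite gmulfM -[hecke_word _ [:: Ordinal jr]]/(gen (Ordinal jr)) !PE.
    have [u su <-] := @word_in_W m _ _ _ _ h1 h2.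
    exact: (absorbs_word (hecke_longestP _)).
  by rewrite !inE eqxx (negbTE hij).
have order i j : i < r -> j < r -> i != j ->
    (L i < L j) && (H i < H j) || (L j < L i) && (H j < H i).
  move=> ir jr nij; have := nc i j ir jr nij.
  by have := nc j i jr ir; rewrite eq_sym nij => /(_ isT); lia.
have far i j : i.+1 < j < r -> (H i < L j) || (H j < L i).
  move=> h; have ir : i < r by lia.
  have jr : j < r by lia.
  have := @hecke_gen_far r (Ordinal ir) (Ordinal jr) ltac:(rewrite /=; lia).
  move=> /(congr1 phi); rewrite !gmulfM !PE => e.
  have := bnd i ir; have := bnd j jr.
  have nij : i != j by lia.
  case/orP: (order i j ir jr nij) => /andP[o1 o2] b1 b2.
    have [//|le] := ltnP (H i) (L j).
    by case: (@W_overlap_comm m (L i) (H i) (L j) (H j)) => //; lia.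
  have [|le] := ltnP (H j) (L i); first by rewrite orbT.
  by case: (@W_overlap_comm m (L j) (H j) (L i) (H i)) => //; lia.
have touch i : i.+1 < r -> (L i.+1 <= H i) && (L i <= H i.+1).
  move=> ir1; have ir : i < r by lia.
  set a := Ordinal ir; set b := Ordinal ir1.
  have /phi_conn : connected_subset (coxB r) [set a; b]%SET.
    apply/connected_subsetP => j1 j2 j3; rewrite !inE => /orP[] /eqP -> /orP[] /eqP -> /=; lia.
  rewrite /hom_supp finset.bigcup_setU !finset.big_set1 /a /b !PE !hecke_supp_longest.
  move=> /connected_subsetP cS; have b1 := bnd i ir; have b2 := bnd i.+1 ir1.
  (* If d < c', the vertex d lies between d - 1 and c' but outside the union. Stated abstractly so
     as to serve both orders of the pair. *)
  have gap c d c' d' : c < d <= m -> c' < d' <= m ->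
      (interval m (L i).+1 (H i) :|: interval m (L i.+1).+1 (H i.+1) =
       interval m c.+1 d :|: interval m c'.+1 d')%SET -> c' <= d.
    move=> h1 h2 eS; rewrite eS in cS; have [//|lt] := leqP c' d.
    have d1m : d.-1 < m by lia.
    have dm : d < m by lia.
    have cm : c' < m by lia.
    have := cS (Ordinal d1m) (Ordinal cm) (Ordinal dm).
    by rewrite !finset.in_setU !mem_interval /=; lia.
  by rewrite (gap _ _ _ _ b1 b2 erefl) (gap _ _ _ _ b2 b1 (finset.setUC _ _)).
have braid i (ir : i < r) (ir1 : i.+1 < r) :
    gprod (fun k => P k) (alternating (Ordinal ir) (Ordinal ir1) (if i.+2 == r then 4 else 3)) =
    gprod (fun k => P k) (alternating (Ordinal ir1) (Ordinal ir) (if i.+2 == r then 4 else 3)).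
  rewrite -!hom_word; congr (phi _); apply/pres_wordP.
  have hij : Ordinal ir != Ordinal ir1 by apply/eqP => -[]; lia.
  have := pres_step [::] [::] (HeckeBraid (coxB r) hij); rewrite /= !cats0.
  rewrite /coxB_m (negbTE hij) /= eqxx /=.
  by have -> : maxn i i.+1 = i.+1 by lia.
have b3 i : i.+2 < r ->
    [/\ L i < L i.+1, H i < H i.+1 < m, L i.+1 - L i <= (H i).+1 - L i.+1 &
      H i.+1 - H i <= (H i).+1 - L i.+1] \/
    [/\ L i.+1 < L i & H i.+1 < H i < m].
  move=> ir2; have ir1 : i.+1 < r by lia.
  have ir : i < r by lia.
  have := braid i ir ir1; have -> : (i.+2 == r) = false by lia.
  rewrite /alternating /mkseq /= !mulg1 !mulgA !PE => e.
  have := bnd i ir; have := bnd i.+1 ir1; have := touch i ir1.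
  have nij : i != i.+1 by lia.
  case/orP: (order i i.+1 ir ir1 nij) => /andP[o1 o2] t b1 b2.
    by have [||] := @W_braid3 m _ _ _ _ _ _ e; [lia|lia|left; split; lia].
  by have [||] := @W_braid3 m _ _ _ _ _ _ (esym e); [lia|lia|right; split; lia].
have b4 i : i.+2 = r -> L i < L i.+1 -> H i < H i.+1 -> H i.+1 = m ->
    L i.+1 - L i <= (H i).+1 - L i.+1.
  move=> ir2 o1 o2 et; have ir1 : i.+1 < r by lia.
  have ir : i < r by lia.
  have := braid i ir ir1; rewrite ir2 eqxx.
  rewrite /alternating /mkseq /= !mulg1 !mulgA !PE => e.
  have := bnd i.+1 ir1; have := touch i ir1 => t b1.
  by apply: (@W_top_JKJK m _ _ _ _ _ _ et e); lia.
have full k : k < m -> exists2 i, i < r & L i <= k < H i.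
  move=> km; have := finset.in_setT (Ordinal km); rewrite -phi_full.
  move=> /finset.bigcupP[i _]; have [_ ->] := hLH i.
  by rewrite hecke_supp_longest mem_interval; exists i.
have [p [l [k [h1 h2 h3 h4]]]] := classify hr bnd nc far b3 touch b4 full.
exists p, l, k; split=> // i; have [e1 e2] := h4 i (ltn_ord i).
by rewrite -e1 -e2; have [] := hLH i.
Qed.

End Converse.

Lemma posB_of r m p l k : 3 <= r -> 0 < p <= l -> l <= k ->
  m = (k + (r - 2) * l + p)%N ->
  exists mu, [/\ posB r m mu, part mu 1 = k, part mu 2 = l & part mu r = p].
Proof.
move=> hr hp hl hm.
exists (mkseq (fun j => if j == 0%N then k else if j == r.-1 then p else l) r).
have E j : 1 <= j <= r -> part (mkseq (fun j => if j == 0%N then k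
    else if j == r.-1 then p else l) r) j =
    if j == 1%N then k else if j == r then p else l.
  move=> hj; rewrite /part nth_mkseq; last by lia.
  have -> : (j.-1 == 0%N) = (j == 1%N) by lia.
  by have -> : (j.-1 == r.-1) = (j == r) by lia.
have e1 : 1 <= 1 <= r by lia.
have e2 : 1 <= 2 <= r by lia.
have e3 : 1 <= r <= r by lia.
have f2 : (2 == r) = false by lia.
have f1 : (r == 1%N) = false by lia.
have E1 := E 1%N e1; have E2 := E 2 e2; have Er := E r e3.
rewrite ?f1 ?f2 ?eqxx /= ?f2 in E1 E2 Er.
have mid j : 2 <= j <= r - 1 -> part (mkseq (fun j => if j == 0%N then k
    else if j == r.-1 then p else l) r) j = l.
  move=> hj; rewrite E; last by lia.
  have -> : (j == 1%N) = false by lia.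
  by have -> : (j == r) = false by lia.
split=> //; split.
- by rewrite size_mkseq.
- by move=> j hj; rewrite E //; case: ifP => _; [lia|case: ifP; lia].
- by move=> j hj; rewrite E2 mid.
- by rewrite Er (mid (r - 1)) ?E1 ?E2; lia.
- by rewrite sum_parts // => [|j hj]; rewrite ?E1 ?E2 ?Er ?mid.
Qed.

Theorem theorem5p12 (r m : nat) (hr : 3 <= r) (hm : r <= m) :
  exists theta : seq nat -> heckeHom (coxB r) (coxB m),
    (forall mu : seq nat, posB r m mu ->
      [/\ posA r (m - part mu 1 + part mu 2) (mu_prime mu),
          forall i : 'I_r, theta mu (hecke_gen (coxB r) i) = theta_gen m mu i,
          locally_injective (theta mu)
        & connected_hom (theta mu)]) /\
    (forall phi : heckeHom (coxB r) (coxB m),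
      locally_injective phi -> connected_hom phi -> fully_supported phi ->
      exists2 mu : seq nat, posB r m mu & phi =1 theta mu).
Proof.
have /choice[theta thetaE] : forall mu : seq nat,
    exists phi : heckeHom (coxB r) (coxB m), posB r m mu ->
      forall i : 'I_r, phi (hecke_gen (coxB r) i) = theta_gen m mu i.
  move=> mu; have [hmu|nmu] := pselect (posB r m mu).
    have [phi phiE] := chain_hom_exists (chain_theta hr hmu).
    by exists phi => _ i; rewrite phiE (theta_genE hr hmu).
  (* Outside B_r(m) the trivial homomorphism serves as default value. *)
  have prod1 u : gprod (fun=> 1 : hecke (coxB m)) u = 1 :> hecke (coxB m).
    by elim: u => //= i u ->; rewrite mulg1.
  have [i|i j _|phi _] := @hecke_hom_exists _ _ (coxB r) (coxB m) (fun=> 1).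
  - exact: mulg1.
  - by rewrite !prod1.
  by exists phi.
exists theta; split=> [mu hmu|phi phi_inj phi_conn phi_full].
  have E i : theta mu (hecke_gen (coxB r) i) =
      chain_gen m (lo_of (part mu r) (part mu 2)) (hi_of r m (part mu r) (part mu 2)) i.
    by rewrite thetaE // (theta_genE hr hmu).
  split.
  - exact: posA_mu_prime.
  - exact: thetaE.
  - exact: chain_locally_injective (chain_theta hr hmu) _ E.
  - exact: chain_connected (chain_theta hr hmu) _ E.
have [p [l [k [h1 h2 h3 phiE]]]] := phi_theta_gen hr phi_inj phi_conn phi_full.
have [mu [hmu e1 e2 e3]] := posB_of hr h1 h2 h3.
exists mu => //; apply: heckeHom_ext => i.
by rewrite thetaE // (theta_genE hr hmu) e2 e3 phiE.
Qed.
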